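(* There is a computable age $\mathbb K$ (in some countable language), which is the canonical computable age of some (computable) structure, such that $\mathbb K$ has the cofinal amalgamation property (CAP) but, for every Turing degree $\mathfrak s$, if $\mathbb K$ has the $\mathfrak s$-computable cofinal amalgamation property $\mathfrak s$-(cCAP), then $\mathbf{0''}\leq_{\mathrm T}\mathfrak s$.
   Context: Languages and structures. $\mathcal{L}$ is a countable (possibly infinite) language with a computable representation: relation symbols $R_n$ (of positive arity) and function symbols $F_m$ are indexed bijectively by disjoint computable subsets of $\omega$, with arity computable from the index. An $\mathcal{L}$-structure $\mathcal{M}$ is c.e. if its underlying set $M$ is a c.e. subset of $\omega$ and the sets $\{(n,\mathbf a): \mathcal M\models R_n(\mathbf a)\}$, $\{(n,\mathbf a): \mathcal M\models \neg R_n(\mathbf a)\}$, $\{(m,\mathbf a,b): \mathcal M\models F_m(\mathbf a)=b\}$ are c.e.; it is computable if moreover $M$ is computable. Tuples are finite; $\mathrm{cl}_{\mathcal M}(\mathbf a)$ is the smallest substructure of $\mathcal M$ containing $\mathbf a$. For $\mathbf a\in\mathcal A$, $\mathbf b\in\mathcal B$ of the same length, $\mathbf a\simeq\mathbf b$ means that for every atomic $\mathcal L$-formula $\varphi$, $\mathcal A\models\varphi(\mathbf a)$ iff $\mathcal B\models\varphi(\mathbf b)$; equivalently $\mathbf a\mapsto\mathbf b$ extends to an isomorphism $\mathrm{cl}(\mathbf a)\to\mathrm{cl}(\mathbf b)$. $\mathbf{0''}$ is the double Turing jump of the least Turing degree. Ages. An age is a collection of finitely generated $\mathcal L$-structures closed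 under isomorphism. A computable age (computable representation of an age $\mathcal K$) is a c.e. set $\mathbb K$ of triples $(\mathbf a,\mathcal A,i)$ (computable structures being given by indices), with exactly one triple for each $i\in\omega$, written $\mathbb I(i)=(\mathbf a_i,\mathcal A_i,i)$, such that each $\mathcal A_i$ is a computable $\mathcal L$-structure in $\mathcal K$ with $\mathcal A_i=\mathrm{cl}_{\mathcal A_i}(\mathbf a_i)$, and every $\mathcal B\in\mathcal K$ is isomorphic to some $\mathcal A_i$. $\mathbb K$ is said to have a property of ages if $\mathcal K$ does. For a computable structure $\mathcal M$, a canonical computable age of $\mathcal M$ is the sequence $(\mathbf a_i,\mathrm{cl}_{\mathcal M}(\mathbf a_i),i)_{i\in\omega}$, where $(\mathbf a_i)_{i\in\omega}$ is a computable enumeration of all finite tuples in $\mathcal M$ in which every tuple appears infinitely often (any two are computably isomorphic); it represents the age of $\mathcal M$, i.e. the collection of structures isomorphic to a finitely generated substructure of $\mathcal M$. Embeddings and amalgamation diagrams. A potential embedding in $\mathbb K$ is a triple $F=(\mathbb I(i),\mathbb I(j),\mathbf c)$ with $\mathbf c\in\mathcal A_j$; $\mathrm{dom}(F)=\mathbb I(i)$, $\mathrm{codom}(F)=\mathbb I(j)$. It is an embedding if $\mathbf a_i\simeq\mathbf c$ (it then encodes the embedding $\mathcal A_i\to\mathcal A_j$ sending $\mathbf a_i$ to $\mathbf c$); composition of embeddings is composition of the encoded maps, and an isomorphism is an embedding whose encoded map is onto. A potential span is a pair $(F_0,F_1)$ of potential embeddings with $\mathrm{dom}(F_0)=\mathrm{dom}(F_1)$;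 it is a span if both are embeddings. An amalgamation diagram over a potential span $(F_0,F_1)$ is a pair $(G_0,G_1)$ with $G_0$ an embedding, $G_1$ a potential embedding, $\mathrm{dom}(G_i)=\mathrm{codom}(F_i)$ for $i\in\{0,1\}$, $\mathrm{codom}(G_0)=\mathrm{codom}(G_1)$, and such that if $(F_0,F_1)$ is a span then $G_1$ is an embedding and $G_0\circ F_0=G_1\circ F_1$. Cofinal amalgamation. An amalgamation base is an $\mathcal A'\in\mathcal K$ such that whenever $\mathcal B,\mathcal C\in\mathcal K$ and $f_{\mathcal B}:\mathcal A'\to\mathcal B$, $f_{\mathcal C}:\mathcal A'\to\mathcal C$ are embeddings, there are $\mathcal D\in\mathcal K$ and embeddings $\alpha_{\mathcal B}:\mathcal B\to\mathcal D$, $\alpha_{\mathcal C}:\mathcal C\to\mathcal D$ with $\alpha_{\mathcal B}\circ f_{\mathcal B}=\alpha_{\mathcal C}\circ f_{\mathcal C}$. (CAP): every $\mathcal A\in\mathcal K$ embeds into some amalgamation base in $\mathcal K$. A collection of distinguished extensions is a collection of embeddings in $\mathbb K$ closed under pre- and post-composition with isomorphisms between elements of $\mathbb K$ and such that every $\mathbb I(i)$ is the domain of some member. A witness to (CAP) is a pair $(\mathrm{AB},f)$ where $\mathrm{AB}$ is a collection of distinguished extensions each of whose members has an amalgamation base as codomain, and $f$ takes each tuple $(F,G_0,G_1)$ with $F\in\mathrm{AB}$, $(G_0,G_1)$ a potential span and $\mathrm{dom}(G_0)=\mathrm{dom}(G_1)=\mathrm{codom}(F)$ to an amalgamation diagram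 over $(G_0,G_1)$. It is $\mathfrak s$-computable if $\mathrm{AB}$ is $\mathfrak s$-c.e. and $f$ is an $\mathfrak s$-computable partial function. $\mathbb K$ has $\mathfrak s$-(cCAP) if it has an $\mathfrak s$-computable witness to (CAP). *)

(* Defs.v *)
From mathcomp Require Import all_boot.
From Stdlib Require Cantor List.

Set Implicit Arguments.
Unset Strict Implicit.
Unset Printing Implicit Defensive.

Definition npair (x y : nat) : nat := Cantor.to_nat (x, y).
Definition nfst (n : nat) : nat := (Cantor.of_nat n).1.
Definition nsnd (n : nat) : nat := (Cantor.of_nat n).2.

Fixpoint scode (s : seq nat) : nat :=
  if s is x :: s' then (npair x (scode s')).+1 else 0.

(* Unary presentation of the partial recursive functions relative to an
   oracle: several arguments are passed through [npair]. *)
Inductive prog : Type :=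
  | PZero | PSucc | PFst | PSnd | POracle
  | PPair of prog & prog
  | PComp of prog & prog
  | PRec of prog & prog
  | PMu of prog.

Inductive eval (S : nat -> Prop) : prog -> nat -> nat -> Prop :=
  | EZero n : eval S PZero n 0
  | ESucc n : eval S PSucc n n.+1
  | EFst n : eval S PFst n (nfst n)
  | ESnd n : eval S PSnd n (nsnd n)
  | EOracle1 n : S n -> eval S POracle n 1
  | EOracle0 n : ~ S n -> eval S POracle n 0
  | EPair p q n x y :
      eval S p n x -> eval S q n y -> eval S (PPair p q) n (npair x y)
  | EComp p q n x y :
      eval S q n x -> eval S p x y -> eval S (PComp p q) n y
  | ERec0 p q a x : eval S p a x -> eval S (PRec p q) (npair a 0) x
  | ERecS p q a n x y :
      eval S (PRec p q) (npair a n) x -> eval S q (npair a (npair n x)) y ->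
      eval S (PRec p q) (npair a n.+1) y
  (* [r] collects the predecessors of the nonzero values below the least zero *)
  | EMu p a n (r : nat -> nat) :
      (forall k, k < n -> eval S p (npair a k) (r k).+1) ->
      eval S p (npair a n) 0 -> eval S (PMu p) a n.

(* Goedel numbering; numbers outside the (decidable) range index the nowhere
   defined function. *)
Fixpoint gn (p : prog) : nat :=
  match p with
  | PZero => npair 0 0
  | PSucc => npair 1 0
  | PFst => npair 2 0
  | PSnd => npair 3 0
  | POracle => npair 4 0
  | PPair p q => npair 5 (npair (gn p) (gn q))
  | PComp p q => npair 6 (npair (gn p) (gn q))
  | PRec p q => npair 7 (npair (gn p) (gn q))
  | PMu p => npair 8 (gn p)
  end.

Definition no_oracle : nat -> Prop := fun _ => False.

Definition jump (S : nat -> Prop) : nat -> Prop :=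
  fun e => exists p y, gn p = e /\ eval S p e y.

(* Turing degrees are handled through representatives S : nat -> Prop. *)
Definition turing_le (A B : nat -> Prop) : Prop :=
  exists p, forall n, (A n -> eval B p n 1) /\ (~ A n -> eval B p n 0).

Definition semidecides (S : nat -> Prop) (p : prog) (A : nat -> Prop) : Prop :=
  forall n, A n <-> exists y, eval S p n y.

Definition ce (S A : nat -> Prop) : Prop := exists p, semidecides S p A.

Definition computes (p : prog) (f : nat -> nat) : Prop :=
  forall n, eval no_oracle p n (f n).

Definition computable_fun (f : nat -> nat) : Prop := exists p, computes p f.

Record language : Type := Language {
  is_rel : pred nat;
  is_fun : pred nat;
  ar : nat -> nat;
  rel_fun_disjoint : forall n, ~~ (is_rel n && is_fun n);
  rel_ar_gt0 : forall n, is_rel n -> 0 < ar n;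
  is_rel_computable : computable_fun (fun n => is_rel n);
  is_fun_computable : computable_fun (fun n => is_fun n);
  ar_computable :
    exists p, forall n, is_rel n || is_fun n -> eval no_oracle p n (ar n) }.

Definition rel_sym (L : language) : Type := {n : nat | is_rel L n}.
Definition fun_sym (L : language) : Type := {n : nat | is_fun L n}.
Definition rar (L : language) (r : rel_sym L) : nat := ar L (val r).
Definition far (L : language) (g : fun_sym L) : nat := ar L (val g).

Record interp (L : language) (T : Type) : Type := Interp {
  rel_in : forall r : rel_sym L, (rar r).-tuple T -> Prop;
  fn_in : forall g : fun_sym L, (far g).-tuple T -> T }.

(* The carrier may be empty when L has no constant symbol. *)
Record structure (L : language) : Type := Structure {
  carrier :> Type;
  interp_of : interp L carrier }.

Definition rel (L : language) (A : structure L) (r : rel_sym L)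
  (xs : (rar r).-tuple A) : Prop := rel_in (interp_of A) xs.
Definition fn (L : language) (A : structure L) (g : fun_sym L)
  (xs : (far g).-tuple A) : A := fn_in (interp_of A) xs.
Arguments rel {L} A r xs.
Arguments fn {L} A g xs.

Record nstructure (L : language) : Type := NStructure {
  dom : pred nat;
  ninterp : interp L {n : nat | dom n} }.

Definition nstr (L : language) (A : nstructure L) : structure L :=
  @Structure L {n : nat | dom A n} (ninterp A).
Coercion nstr : nstructure >-> structure.

Definition nval (L : language) (A : nstructure L) (x : A) : nat := sval x.

Definition tcode (L : language) (A : nstructure L) (s : seq A) : nat :=
  scode (map (@nval L A) s).

Definition rel_set (L : language) (A : nstructure L) (t : nat) : Prop :=
  exists (r : rel_sym L) (xs : (rar r).-tuple A),
    rel A r xs /\ t = scode [:: val r; tcode xs].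
Definition nrel_set (L : language) (A : nstructure L) (t : nat) : Prop :=
  exists (r : rel_sym L) (xs : (rar r).-tuple A),
    ~ rel A r xs /\ t = scode [:: val r; tcode xs].
Definition fn_set (L : language) (A : nstructure L) (t : nat) : Prop :=
  exists (g : fun_sym L) (xs : (far g).-tuple A),
    t = scode [:: val g; tcode xs; nval (fn A g xs)].

Definition is_index (L : language) (e : nat) (A : nstructure L) : Prop :=
  exists pd pr pn pf,
    e = scode [:: gn pd; gn pr; gn pn; gn pf] /\
    [/\ computes pd (fun n => dom A n),
        semidecides no_oracle pr (rel_set A),
        semidecides no_oracle pn (nrel_set A)
      & semidecides no_oracle pf (fn_set A)].

Definition computable_structure (L : language) (A : nstructure L) : Prop :=
  exists e, is_index e A.

Inductive in_cl (L : language) (A : structure L) (a : seq A) : A -> Prop :=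
  | in_cl_gen x : List.In x a -> in_cl a x
  | in_cl_fn g (xs : (far g).-tuple A) :
      (forall i, in_cl a (tnth xs i)) -> in_cl a (fn A g xs).

Definition generates (L : language) (A : structure L) (a : seq A) : Prop :=
  forall x, in_cl a x.

Definition embedding (L : language) (A B : structure L) (f : A -> B) : Prop :=
  [/\ injective f,
      forall r xs, rel A r xs <-> rel B r (map_tuple f xs)
    & forall g xs, f (fn A g xs) = fn B g (map_tuple f xs)].

Definition onto (T U : Type) (f : T -> U) : Prop := forall y, exists x, f x = y.

Definition isomorphic (L : language) (A B : structure L) : Prop :=
  exists f : A -> B, embedding f /\ onto f.

Inductive term (L : language) (n : nat) : Type :=
  | Var of 'I_n
  | App (g : fun_sym L) of ('I_(far g) -> term L n).

Inductive atomic (L : language) (n : nat) : Type :=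
  | AEq of term L n & term L n
  | ARel (r : rel_sym L) of ('I_(rar r) -> term L n).

Fixpoint teval (L : language) (A : structure L) (n : nat) (a : n.-tuple A)
    (t : term L n) : A :=
  match t with
  | Var i => tnth a i
  | App g ts => fn A g [tuple teval a (ts i) | i < far g]
  end.

Definition holds (L : language) (A : structure L) (n : nat) (a : n.-tuple A)
    (phi : atomic L n) : Prop :=
  match phi with
  | AEq t u => teval a t = teval a u
  | ARel r ts => rel A r [tuple teval a (ts i) | i < rar r]
  end.

Definition simeq (L : language) (A B : structure L) (a : seq A) (b : seq B) :
    Prop :=
  exists n (u : n.-tuple A) (v : n.-tuple B),
    [/\ a = u, b = v
      & forall phi : atomic L n, holds u phi <-> holds v phi].

Definition is_age (L : language) (K : structure L -> Prop) : Prop :=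
  (forall A, K A -> exists a : seq A, generates a) /\
  (forall A B, K A -> isomorphic A B -> K B).

Definition amalgamation_base (L : language) (K : structure L -> Prop)
    (A : structure L) : Prop :=
  K A /\
  forall (B C : structure L) (fB : A -> B) (fC : A -> C),
    K B -> K C -> embedding fB -> embedding fC ->
    exists (D : structure L) (gB : B -> D) (gC : C -> D),
      [/\ K D, embedding gB, embedding gC & forall x, gB (fB x) = gC (fC x)].

Definition CAP (L : language) (K : structure L -> Prop) : Prop :=
  forall A, K A ->
    exists (B : structure L) (f : A -> B), amalgamation_base K B /\ embedding f.

(* The i-th triple of the age is (gen i, str i, i), the structure str i being
   given by the index idx i. *)
Record computable_age (L : language) : Type := ComputableAge {
  str : nat -> nstructure L;
  gen : forall i, seq (str i);
  idx : nat -> nat;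
  idxP : forall i, is_index (idx i) (str i);
  gen_generates : forall i, generates (gen i);
  triples_ce : ce no_oracle
    (fun t => exists i, t = scode [:: tcode (gen i); idx i; i]) }.

Definition represents (L : language) (KK : computable_age L)
    (K : structure L -> Prop) : Prop :=
  (forall i, K (str KK i)) /\
  (forall B, K B -> exists i, isomorphic B (str KK i)).

(* [incl i] is the inclusion of [str i] in M; its image is cl_M(a_i), so that
   [str i] is the substructure cl_M(a_i) itself and not merely a copy of it. *)
Definition canonical_age (L : language) (M : nstructure L)
    (KK : computable_age L) : Prop :=
  exists (a : nat -> seq M) (incl : forall i, str KK i -> M),
    [/\ computable_fun (fun i => tcode (a i)),
        forall (s : seq M) (n : nat), exists i, n <= i /\ a i = s
      & forall i,
        [/\ embedding (incl i),
            forall x, nval (incl i x) = nval x,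
            forall y, in_cl (a i) y <-> exists x, incl i x = y
          & map (incl i) (gen KK i) = a i]].

(* Domain and codomain are type indices, so side conditions such as
   dom(F0) = dom(F1) are enforced by typing. *)

Record pemb (L : language) (KK : computable_age L) (i j : nat) : Type :=
  PEmb { tup : seq (str KK j) }.

(* The triples indexed by i and j are computable from i and j, hence are coded
   by i and j alone. *)
Definition ecode (L : language) (KK : computable_age L) (i j : nat)
  (F : pemb KK i j) : nat := scode [:: i; j; tcode (tup F)].

Definition is_emb (L : language) (KK : computable_age L) (i j : nat)
  (F : pemb KK i j) : Prop := simeq (gen KK i) (tup F).

Definition encodes (L : language) (KK : computable_age L) (i j : nat)
    (F : pemb KK i j) (f : str KK i -> str KK j) : Prop :=
  embedding f /\ map f (gen KK i) = tup F.

Definition is_iso (L : language) (KK : computable_age L) (i j : nat)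
    (F : pemb KK i j) : Prop :=
  is_emb F /\ exists f, encodes F f /\ onto f.

(* The embedding H is G o F. *)
Definition is_comp (L : language) (KK : computable_age L) (i j k : nat)
    (G : pemb KK j k) (F : pemb KK i j) (H : pemb KK i k) : Prop :=
  exists f g, [/\ encodes F f, encodes G g & encodes H (g \o f)].

Definition is_span (L : language) (KK : computable_age L) (i j k : nat)
    (F0 : pemb KK i j) (F1 : pemb KK i k) : Prop :=
  is_emb F0 /\ is_emb F1.

Definition amalgamation_diagram (L : language) (KK : computable_age L)
    (i j k l : nat) (F0 : pemb KK i j) (F1 : pemb KK i k)
    (G0 : pemb KK j l) (G1 : pemb KK k l) : Prop :=
  is_emb G0 /\
  (is_span F0 F1 ->
   is_emb G1 /\ exists H : pemb KK i l, is_comp G0 F0 H /\ is_comp G1 F1 H).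

Definition distinguished_extensions (L : language) (KK : computable_age L)
    (AB : forall i j, pemb KK i j -> Prop) : Prop :=
  [/\ forall i j (F : pemb KK i j), AB i j F -> is_emb F,
      forall h i j (E : pemb KK h i) (F : pemb KK i j) (H : pemb KK h j),
        is_iso E -> AB i j F -> is_comp F E H -> AB h j H,
      forall i j k (F : pemb KK i j) (E : pemb KK j k) (H : pemb KK i k),
        is_iso E -> AB i j F -> is_comp E F H -> AB i k H
    & forall i, exists j (F : pemb KK i j), AB i j F].

(* Partial functions taking (F, G0, G1), where (G0, G1) is a potential span
   on codom(F), to a pair of potential embeddings with common codomain m. *)
Definition diagram_pfun (L : language) (KK : computable_age L) : Type :=
  forall i j k l, pemb KK i j -> pemb KK j k -> pemb KK j l ->
    option {m : nat & (pemb KK k m * pemb KK l m)%type}.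

Definition CAP_witness (L : language) (K : structure L -> Prop)
    (KK : computable_age L) (AB : forall i j, pemb KK i j -> Prop)
    (f : diagram_pfun KK) : Prop :=
  [/\ distinguished_extensions AB,
      forall i j (F : pemb KK i j), AB i j F ->
        amalgamation_base K (str KK j)
    & forall i j k l (F : pemb KK i j) (G0 : pemb KK j k) (G1 : pemb KK j l),
        AB i j F ->
        exists m (H0 : pemb KK k m) (H1 : pemb KK l m),
          f i j k l F G0 G1 = Some (existT _ m (H0, H1)) /\
          amalgamation_diagram G0 G1 H0 H1].

Definition computable_witness (L : language) (S : nat -> Prop)
    (KK : computable_age L) (AB : forall i j, pemb KK i j -> Prop)
    (f : diagram_pfun KK) : Prop :=
  ce S (fun t => exists i j (F : pemb KK i j), AB i j F /\ t = ecode F) /\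
  exists p, forall i j k l (F : pemb KK i j) (G0 : pemb KK j k)
      (G1 : pemb KK j l) (y : nat),
    eval S p (scode [:: ecode F; ecode G0; ecode G1]) y <->
    exists m (H0 : pemb KK k m) (H1 : pemb KK l m),
      f i j k l F G0 G1 = Some (existT _ m (H0, H1)) /\
      y = scode [:: ecode H0; ecode H1].

Definition cCAP (L : language) (S : nat -> Prop) (K : structure L -> Prop)
    (KK : computable_age L) : Prop :=
  exists (AB : forall i j, pemb KK i j -> Prop) (f : diagram_pfun KK),
    CAP_witness K AB f /\ computable_witness S AB f.

(* Main.v *)
Require Import Defs.
From mathcomp Require Import all_boot.
From Stdlib Require Import ClassicalEpsilon.

(* The structures are finite directed graphs in which edges lead from roots to
   leaves.  A root stands for an instance z of a Sigma_2 question "is some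
   candidate i never refuted?", a leaf for a candidate, each candidate having
   several leaf labels.  The only constraint is that the unrefuted children of
   a root have the same label.  This is enforced inside a computable structure
   by letting every root announce a label and a stage, children with another
   label counting only if they are refuted by that stage.

   If z has an unrefuted candidate, then a root for z without an unrefuted
   child has incompatible extensions by two differently labelled children.  If
   every root has an unrefuted child whenever it has an unrefuted candidate,
   then free amalgamation stays within the class.  Hence the class has CAP,
   and every amalgamation base above a root for z contains an unrefuted
   candidate, if there is one, below the number of the base: a witness to
   cCAP computes a bound h for unrefuted candidates.  The second jump is a
   Sigma_2 set of such questions, and another use of h tells the refuted
   candidates below the bound from the unrefuted ones. *)

Set Implicit Arguments.
Unset Strict Implicit.
Unset Printing Implicit Defensive.

(** * Pairing and the evaluation relation *)

Arguments npair : simpl never.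
Arguments nfst : simpl never.
Arguments nsnd : simpl never.

Lemma nfst_npair x y : nfst (npair x y) = x.
Proof. by rewrite /nfst /npair Cantor.cancel_of_to. Qed.

Lemma nsnd_npair x y : nsnd (npair x y) = y.
Proof. by rewrite /nsnd /npair Cantor.cancel_of_to. Qed.

Definition npairE := (nfst_npair, nsnd_npair).

Lemma npair_fst_snd n : npair (nfst n) (nsnd n) = n.
Proof. by rewrite /npair /nfst /nsnd -surjective_pairing Cantor.cancel_to_of. Qed.

Lemma npair_inj x y x' y' : npair x y = npair x' y' -> x = x' /\ y = y'.
Proof.
by move=> e; move: (congr1 nfst e) (congr1 nsnd e); rewrite !npairE.
Qed.

Lemma npair_eq x y x' y' : (npair x y == npair x' y') = (x == x') && (y == y').
Proof.
apply/eqP/andP => [/npair_inj[-> ->] //|[/eqP-> /eqP->] //].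
Qed.

Lemma npair_lel x y : x <= npair x y.
Proof.
apply: leq_trans (leq_addl y x) _.
exact/leP/Cantor.to_nat_non_decreasing.
Qed.

Lemma npair_ler x y : y <= npair x y.
Proof.
apply: leq_trans (leq_addr x y) _.
exact/leP/Cantor.to_nat_non_decreasing.
Qed.

Lemma nfst_le n : nfst n <= n.
Proof. by rewrite -{2}(npair_fst_snd n) npair_lel. Qed.

Lemma nsnd_le n : nsnd n <= n.
Proof. by rewrite -{2}(npair_fst_snd n) npair_ler. Qed.

Lemma eval_PRec_inv S p q m y : eval S (PRec p q) m y ->
  if nsnd m is n.+1 then
    exists x, eval S (PRec p q) (npair (nfst m) n) x /\
              eval S q (npair (nfst m) (npair n x)) y
  else eval S p (nfst m) y.
Proof. by move=> e; inversion e; subst; rewrite !npairE //; exists x. Qed.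

Lemma eval_PMu_inv S p a n : eval S (PMu p) a n ->
  (forall k, k < n -> exists y, eval S p (npair a k) y.+1) /\
  eval S p (npair a n) 0.
Proof.
move Eq: (PMu p) => q e; case: _ a n / e Eq => // ? {}a {}n r evr ev0 [->].
by split=> // k /evr; exists (r k).
Qed.

Lemma eval_functional S p n x y : eval S p n x -> eval S p n y -> x = y.
Proof.
move=> ev; elim: ev y => {p n x}.
- by move=> n y e; inversion e.
- by move=> n y e; inversion e.
- by move=> n y e; inversion e.
- by move=> n y e; inversion e.
- by move=> n Sn y e; inversion e.
- by move=> n Sn y e; inversion e.
- move=> p q n x y _ IHp _ IHq z e; inversion e; subst.
  by congr npair; [apply: IHp | apply: IHq].
- move=> p q n x y _ IHq _ IHp z e; inversion e; subst.
  by apply: IHp; rewrite (IHq x0).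
- by move=> p q a x _ IHp z /eval_PRec_inv; rewrite !npairE => /IHp.
- move=> p q a n x y _ IHp _ IHq z /eval_PRec_inv; rewrite !npairE.
  by case=> x' [/IHp <- /IHq].
- move=> p a n r evk IHk _ IH0 z /eval_PMu_inv[evk' ev0'].
  case: (ltngtP n z) => // lt_nz.
  + by have [k /IH0] := evk' _ lt_nz.
  + by have := IHk _ lt_nz _ ev0'.
Qed.

(** * Closure properties of the functions computable in an oracle *)

Definition computable_in (S : nat -> Prop) (f : nat -> nat) : Prop :=
  exists p, forall n, eval S p n (f n).

Section Closure.

Variable S : nat -> Prop.
Local Notation comp := (computable_in S).

Lemma comp_ext f g : f =1 g -> comp f -> comp g.
Proof. by move=> fg [p pf]; exists p => n; rewrite -fg. Qed.

Definition prog_id := PPair PFst PSnd.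

Lemma eval_prog_id n : eval S prog_id n n.
Proof. by rewrite -{2}(npair_fst_snd n); do !constructor. Qed.

Fixpoint prog_const k :=
  if k is k'.+1 then PComp PSucc (prog_const k') else PZero.

Lemma eval_prog_const k n : eval S (prog_const k) n k.
Proof.
elim: k => [|k IH] /=; first exact: EZero.
by apply: EComp IH _; apply: ESucc.
Qed.

Lemma comp_id : comp id.
Proof. by exists prog_id; apply: eval_prog_id. Qed.

Lemma comp_const k : comp (fun=> k).
Proof. by exists (prog_const k); apply: eval_prog_const. Qed.

Lemma comp_comp f g : comp f -> comp g -> comp (fun n => f (g n)).
Proof.
by move=> [p pf] [q qg]; exists (PComp p q) => n; apply: EComp (qg n) (pf _).
Qed.

Lemma comp_nfst f : comp f -> comp (fun n => nfst (f n)).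
Proof. by apply: comp_comp; exists PFst; apply: EFst. Qed.

Lemma comp_nsnd f : comp f -> comp (fun n => nsnd (f n)).
Proof. by apply: comp_comp; exists PSnd; apply: ESnd. Qed.

Lemma comp_succ f : comp f -> comp (fun n => (f n).+1).
Proof. by apply: comp_comp; exists PSucc; apply: ESucc. Qed.

Lemma comp_npair f g : comp f -> comp g -> comp (fun n => npair (f n) (g n)).
Proof.
by move=> [p pf] [q qg]; exists (PPair p q) => n; apply: EPair (pf n) (qg n).
Qed.

Lemma comp_comp2 (F : nat -> nat -> nat) f g :
  comp (fun m => F (nfst m) (nsnd m)) -> comp f -> comp g ->
  comp (fun n => F (f n) (g n)).
Proof.
move=> cF cf cg; apply: comp_ext (comp_comp cF (comp_npair cf cg)) => n.
by rewrite /= !npairE.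
Qed.

Lemma comp_comp3 (F : nat -> nat -> nat -> nat) f g h :
  comp (fun m => F (nfst m) (nfst (nsnd m)) (nsnd (nsnd m))) ->
  comp f -> comp g -> comp h -> comp (fun n => F (f n) (g n) (h n)).
Proof.
move=> cF cf cg ch.
apply: comp_ext (comp_comp cF (comp_npair cf (comp_npair cg ch))) => n.
by rewrite /= !npairE.
Qed.

(** The whole argument [n] is passed as the parameter of [PRec], so the base value, the step and the
    number of steps may all depend on it. *)
Lemma comp_rec g (h : nat -> nat -> nat -> nat) b :
  comp g -> comp (fun m => h (nfst m) (nfst (nsnd m)) (nsnd (nsnd m))) ->
  comp b -> comp (fun n => nat_rect (fun=> nat) (g n) (h n) (b n)).
Proof.
move=> [p pg] [q qh] [r rb].
exists (PComp (PRec p q) (PPair prog_id r)) => n.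
apply: EComp; first by apply: EPair (eval_prog_id n) (rb n).
elim: (b n) => [|k IH] /=; first exact: ERec0.
apply: ERecS IH _; set x := nat_rect _ _ _ _.
by have := qh (npair n (npair k x)); rewrite !npairE.
Qed.

Lemma comp_iter (F : nat -> nat -> nat) g b :
  comp (fun m => F (nfst m) (nsnd m)) -> comp g -> comp b ->
  comp (fun n => iter (b n) (F n) (g n)).
Proof.
move=> cF cg cb.
apply: comp_ext (@comp_rec g (fun n _ x => F n x) b cg _ cb) => [n|].
  by elim: (b n) => //= k ->.
apply: comp_comp2 => //; first exact/comp_nfst/comp_id.
exact/comp_nsnd/comp_nsnd/comp_id.
Qed.

Lemma comp_pred f : comp f -> comp (fun n => (f n).-1).
Proof.
move=> cf; apply: comp_ext (@comp_rec (fun=> 0) (fun _ k _ => k) f _ _ cf).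
- by move=> n /=; case: (f n).
- exact: comp_const.
- exact/comp_nfst/comp_nsnd/comp_id.
Qed.

Lemma comp_subn f g : comp f -> comp g -> comp (fun n => f n - g n).
Proof.
move=> cf cg; apply: comp_ext (comp_iter (F := fun _ => predn) _ cf cg).
  by move=> n; elim: (g n) => [|k /= ->]; rewrite ?subn0 ?subnS.
exact/comp_pred/comp_nsnd/comp_id.
Qed.

(** Booleans are the numbers 0 and 1, so a case distinction is a recursion of at most one step. *)
Lemma comp_if (b : nat -> bool) f g : comp b -> comp f -> comp g ->
  comp (fun n => if b n then f n else g n).
Proof.
move=> cb cf cg.
apply: comp_ext (@comp_rec g (fun n _ _ => f n) (fun n => b n) cg _ cb).
  by move=> n; case: (b n).
by apply: comp_comp => //; apply/comp_nfst/comp_id.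
Qed.

Lemma comp_negb (b : nat -> bool) : comp b -> comp (fun n => ~~ b n).
Proof.
move=> cb; apply: comp_ext (comp_if cb (comp_const 0) (comp_const 1)).
by move=> n; case: (b n).
Qed.

Lemma comp_andb (a b : nat -> bool) :
  comp a -> comp b -> comp (fun n => a n && b n).
Proof.
move=> ca cb; apply: comp_ext (comp_if ca cb (comp_const 0)).
by move=> n; case: (a n).
Qed.

Lemma comp_orb (a b : nat -> bool) :
  comp a -> comp b -> comp (fun n => a n || b n).
Proof.
move=> ca cb; apply: comp_ext (comp_if ca (comp_const 1) cb).
by move=> n; case: (a n).
Qed.

Lemma comp_leq f g : comp f -> comp g -> comp (fun n => f n <= g n).
Proof.
move=> cf cg; pose d n := f n - g n.
apply: comp_ext (@comp_rec (fun=> 1) (fun _ _ _ => 0) d _ _ _).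
- by move=> n; rewrite /leq -/(d n); case: (d n).
- exact: comp_const.
- exact: comp_const.
- exact: comp_subn.
Qed.

Lemma comp_eqn f g : comp f -> comp g -> comp (fun n => f n == g n).
Proof.
move=> cf cg; apply: comp_ext (comp_andb (comp_leq cf cg) (comp_leq cg cf)).
by move=> n; rewrite -eqn_leq.
Qed.

Lemma comp_has_iota (P : nat -> nat -> bool) b :
  comp (fun m => P (nfst m) (nsnd m)) -> comp b ->
  comp (fun n => has (P n) (iota 0 (b n))).
Proof.
move=> cP cb.
pose h n k x := if P n k then 1 else x.
apply: comp_ext (@comp_rec (fun=> 0) h b _ _ cb).
- move=> n; elim: (b n) => // k IH.
  rewrite -[k.+1]addn1 iotaD has_cat addn1 [LHS]/= IH /= orbF /h.
  by case: (P n k); rewrite ?orbT ?orbF.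
- exact: comp_const.
- apply: comp_if; last exact/comp_nsnd/comp_nsnd/comp_id.
    apply: (comp_comp2 (F := P)) => //; first exact/comp_nfst/comp_id.
    exact/comp_nfst/comp_nsnd/comp_id.
  exact: comp_const.
Qed.

Lemma comp_all_iota (P : nat -> nat -> bool) b :
  comp (fun m => P (nfst m) (nsnd m)) -> comp b ->
  comp (fun n => all (P n) (iota 0 (b n))).
Proof.
move=> cP cb.
have cN := comp_has_iota (P := fun n k => ~~ P n k) (comp_negb cP) cb.
apply: comp_ext (comp_negb cN) => n.
by rewrite (has_predC (P n)) negbK.
Qed.

Lemma comp_search (P : nat -> nat -> bool) :
  comp (fun m => P (nfst m) (nsnd m)) -> (forall n, exists k, P n k) ->
  exists2 f, comp f & forall n, P n (f n).
Proof.
move=> /comp_negb[p pP] exP.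
exists (fun n => ex_minn (exP n)); last by move=> n; case: ex_minnP.
exists (PMu p) => n; case: ex_minnP => m Pm min_m.
have := pP (npair n m); rewrite !npairE Pm => ev0.
(* [PMu] searches for a zero, hence runs on the negated test; below the least witness that test has
   value 1, with predecessor 0. *)
apply: (EMu (r := fun=> 0)) => // k lt_km.
have := pP (npair n k); rewrite !npairE.
suff /negPf->: ~~ P n k by [].
by apply/negP => /min_m; rewrite leqNgt lt_km.
Qed.

End Closure.

(** * Oracle queries and lists coded by numbers *)

Definition decide (P : Prop) : bool := excluded_middle_informative P.

Lemma decideP P : reflect P (decide P).
Proof.
by rewrite /decide; case: excluded_middle_informative => ?; constructor.
Qed.

Lemma comp_oracle S f : computable_in S f ->
  computable_in S (fun n => decide (S (f n))).
Proof.
apply: (comp_comp (f := fun n => decide (S n))); exists POracle => n.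
by case: decideP => Sn; [apply: EOracle1 | apply: EOracle0].
Qed.

(** A list is no longer than its code, so [decode] may use the code itself as the fuel [k]. *)
Fixpoint decode_rec k c : seq nat :=
  if k is k'.+1 then
    if c is c'.+1 then nfst c' :: decode_rec k' (nsnd c') else [::]
  else [::].

Definition decode c := decode_rec c c.

Lemma scodeK : cancel scode decode.
Proof.
move=> s; rewrite /decode; suff gen k : scode s <= k -> decode_rec k (scode s) = s.
  exact: gen.
elim: s k => [|x s IH] [|k] //= le_sk; rewrite !npairE IH //.
exact: leq_trans (npair_ler x _) le_sk.
Qed.

Lemma decodeK : cancel decode scode.
Proof.
move=> c; rewrite /decode; suff gen k d : d <= k -> scode (decode_rec k d) = d.
  exact: gen.
elim: k d => [|k IH] [|d] //= le_ck; rewrite IH ?npair_fst_snd //.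
exact: leq_trans (nsnd_le d) le_ck.
Qed.

Lemma size_scode s : size s <= scode s.
Proof. by elim: s => //= x s IH; apply: leq_trans IH (npair_ler x _). Qed.

Lemma mem_lt_scode x s : x \in s -> x < scode s.
Proof.
elim: s => //= y s IH; rewrite inE ltnS => /orP[/eqP-> | /IH/ltnW le_xs].
  exact: npair_lel.
exact: leq_trans le_xs (npair_ler y _).
Qed.

(** [Q] sees each entry together with the entries after it, as suits certificates whose judgements
    are justified by later ones. *)
Fixpoint all_tails (Q : nat -> seq nat -> bool) s :=
  if s is x :: s' then Q x s' && all_tails Q s' else true.

Lemma all_tails_has P s : all_tails (fun x _ => ~~ P x) s = ~~ has P s.
Proof. by elim: s => //= x s ->; rewrite negb_or. Qed.

(** Iterating [fun c => nsnd c.-1] strips heads off a code, which turns recursion on the list into a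
    bounded quantifier over positions. At the empty list, coded by 0, the iteration is stationary,
    so a larger bound is harmless. *)
Lemma all_tails_iota Q s N : size s <= N ->
  all_tails Q s =
  all (fun k => let v := iter k (fun c => nsnd c.-1) (scode s) in
         (v == 0) || Q (nfst v.-1) (decode (nsnd v.-1))) (iota 0 N).
Proof.
elim: s N => [|x s IH] N.
  move=> _; apply/esym/allP => k _ /=; apply/orP; left.
  by elim: k => //= k /eqP->.
case: N => //= N le_sN; rewrite !npairE scodeK; congr (_ && _).
rewrite (IH N) // (iotaDl 1 0) all_map; apply: eq_all => k.
have e : iter k.+1 (fun c => nsnd c.-1) (npair x (scode s)).+1 =
         iter k (fun c => nsnd c.-1) (scode s) by rewrite iterSr /= nsnd_npair.
by rewrite /= -e.
Qed.

(** The shape of the function selects the closure lemma; goals that fit none are left over. *)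
Ltac comp_core :=
  first [assumption |
  lazymatch goal with
  | |- computable_in _ (fun n => nat_of_bool (@?b n)) =>
    lazymatch b with
    | (fun n => ~~ @?P n) => apply: comp_negb
    | (fun n => @?P n && @?Q n) => apply: comp_andb
    | (fun n => @?P n || @?Q n) => apply: comp_orb
    | (fun n => @?f n <= @?g n) => apply: comp_leq
    | (fun n => @?f n == @?g n) => apply: comp_eqn
    | (fun n => has (@?P n) (iota 0 (@?f n))) => apply: (comp_has_iota (P := P))
    | (fun n => all (@?P n) (iota 0 (@?f n))) => apply: (comp_all_iota (P := P))
    | (fun n => decide (?S (@?f n))) => apply: comp_oracle
    | (fun n => _) => apply: comp_const
    end
  | |- computable_in _ (fun n => nfst (@?f n)) => apply: comp_nfst
  | |- computable_in _ nfst => apply: comp_nfst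
  | |- computable_in _ (fun n => nsnd (@?f n)) => apply: comp_nsnd
  | |- computable_in _ nsnd => apply: comp_nsnd
  | |- computable_in _ (fun n => npair (@?f n) (@?g n)) => apply: comp_npair
  | |- computable_in _ (npair _) => apply: comp_npair
  | |- computable_in _ (fun n => (@?f n).+1) => apply: comp_succ
  | |- computable_in _ (fun n => (@?f n).-1) => apply: comp_pred
  | |- computable_in _ (fun n => n) => apply: comp_id
  | |- computable_in _ id => apply: comp_id
  | |- computable_in _ (fun n => _) => apply: comp_const
  end].

Section ListClosure.

Variable S : nat -> Prop.
Local Notation comp := (computable_in S).

Lemma comp_all_tails (Q : nat -> nat -> seq nat -> bool) c :
  comp (fun m => Q (nfst m) (nfst (nsnd m)) (decode (nsnd (nsnd m)))) ->
  comp c -> comp (fun n => all_tails (Q n) (decode (c n))).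
Proof.
move=> cQ cc.
pose v n k := iter k (fun c => nsnd c.-1) (c n).
pose P n k := (v n k == 0) || Q n (nfst (v n k).-1) (decode (nsnd (v n k).-1)).
apply: (comp_ext (f := fun n => all (P n) (iota 0 (c n)))) => [n|].
  have le_size : size (decode (c n)) <= c n.
    by rewrite -{2}(decodeK (c n)) size_scode.
  by rewrite (all_tails_iota _ le_size) decodeK.
have cv : comp (fun m => v (nfst m) (nsnd m)).
  apply: (comp_iter (F := fun _ c => nsnd c.-1)); last by repeat comp_core.
    by repeat comp_core.
  by apply: (comp_comp (f := c)) => //; repeat comp_core.
rewrite /P; repeat comp_core.
by apply: (comp_comp3 (F := fun n x c => Q n x (decode c))); repeat comp_core.
Qed.

Lemma comp_has (P : nat -> nat -> bool) c :
  comp (fun m => P (nfst m) (nsnd m)) -> comp c ->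
  comp (fun n => has (P n) (decode (c n))).
Proof.
move=> cP cc.
have cQ : comp (fun n => ~~ all_tails (fun x _ => ~~ P n x) (decode (c n))).
  apply/comp_negb/(comp_all_tails (Q := fun n x _ => ~~ P n x)) => //.
  by apply/comp_negb/(comp_comp2 (F := P)) => //; repeat comp_core.
by apply: comp_ext cQ => n; rewrite all_tails_has negbK.
Qed.

Lemma comp_mem x c : comp x -> comp c -> comp (fun n => x n \in decode (c n)).
Proof.
move=> cx cc; apply: comp_ext (comp_has (P := fun n y => y == x n) _ cc).
  by move=> n; rewrite -has_pred1.
apply: comp_eqn; first by repeat comp_core.
by apply: (comp_comp (f := x)) => //; repeat comp_core.
Qed.

End ListClosure.

Ltac comp_list :=
  lazymatch goal with
  | |- computable_in _ (fun n => nat_of_bool (@?b n)) =>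
    lazymatch b with
    | (fun n => @?f n \in decode (@?g n)) => apply: comp_mem
    | (fun n => has (@?P n) (decode (@?f n))) => apply: (comp_has (P := P))
    end
  end.
Ltac comp_tac := repeat first [comp_core | comp_list].

(** * Certificates for computations *)

(* A certificate is a list of judgements "program [p] maps [n] to [y]" and
   "[p] is the number of a program", each following from later ones. *)
Definition evj p n y := npair 0 (npair p (npair n y)).
Definition wfj p := npair 1 p.
Definition jout j := nsnd (nsnd (nsnd j)).

Lemma jout_evj p n y : jout (evj p n y) = y.
Proof. by rewrite /jout /evj !npairE. Qed.

(** The output is read off the judgement that is found, so the quantifier over outputs becomes a
    search in [s]. *)
Definition has_ev p n s := has (fun j => j == evj p n (jout j)) s.

Lemma has_evP p n s : reflect (exists y, evj p n y \in s) (has_ev p n s).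
Proof.
apply: (iffP hasP) => [[j js /eqP e] | [y ys]].
  by exists (jout j); rewrite -e.
by exists (evj p n y) => //; rewrite jout_evj.
Qed.

(** The disjuncts follow the constructors of [eval], the two oracle rules being merged; [t] is the
    tag that [gn] gives to the outermost constructor and [c] codes its subprograms. The base case of
    a recursion does not run [b], which is therefore certified to be a program by [wfj]. *)
Definition ev_step (O : nat -> bool) p n y s :=
  let t := nfst p in let c := nsnd p in let a := nfst c in let b := nsnd c in
  [|| [&& t == 0, c == 0 & y == 0],
      [&& t == 1, c == 0 & y == n.+1],
      [&& t == 2, c == 0 & y == nfst n],
      [&& t == 3, c == 0 & y == nsnd n],
      [&& t == 4, c == 0 & y == O n],
      [&& t == 5, evj a n (nfst y) \in s & evj b n (nsnd y) \in s],
      (t == 6) && has (fun j => (j == evj b n (jout j)) &&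
                                (evj a (jout j) y \in s)) s,
      [&& t == 7, nsnd n == 0, evj a (nfst n) y \in s & wfj b \in s],
      [&& t == 7, nsnd n != 0
        & has (fun j =>
            (j == evj p (npair (nfst n) (nsnd n).-1) (jout j)) &&
            (evj b (npair (nfst n) (npair (nsnd n).-1 (jout j))) y \in s)) s]
    | [&& t == 8, evj c (npair n y) 0 \in s
        & all (fun k => has (fun j => (j == evj c (npair n k) (jout j)) &&
                                      (jout j != 0)) s) (iota 0 y)]].

Definition wf_step p (s : seq nat) :=
  let t := nfst p in let c := nsnd p in
  [|| (t < 5) && (c == 0),
      [&& 4 < t, t < 8, wfj (nfst c) \in s & wfj (nsnd c) \in s]
    | (t == 8) && (wfj c \in s)].

Definition justified O j s :=
  (nfst j == 0) &&
    ev_step O (nfst (nsnd j)) (nfst (nsnd (nsnd j))) (jout j) s ||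
  (nfst j == 1) && wf_step (nsnd j) s.

Definition valid O s := all_tails (justified O) s.

Lemma computable_valid S (O : nat -> nat -> bool) c :
  computable_in S (fun m => O (nfst m) (nsnd m)) -> computable_in S c ->
  computable_in S (fun n => valid (O n) (decode (c n))).
Proof.
move=> cO cc; apply: comp_all_tails => //.
rewrite /justified /ev_step /wf_step /evj /wfj /jout.
by comp_tac; apply: (comp_comp2 (F := O)); comp_tac.
Qed.

(** Use principle: the oracle is consulted only at arguments of judgements in [s], and these are
    smaller than the code of [s]. *)
Lemma valid_ext O O' s : (forall n, n < scode s -> O n = O' n) ->
  valid O s = valid O' s.
Proof.
elim: s => //= j s IH eqO; congr (_ && _).
  rewrite /justified /ev_step eqO // ltnS.
  apply: leq_trans (npair_lel _ _); apply: leq_trans (nfst_le _) _.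
  exact: leq_trans (nsnd_le _) (nsnd_le _).
by apply: IH => n lt_ns; apply/eqO/leqW/(leq_trans lt_ns)/npair_ler.
Qed.

Lemma gn_inj : injective gn.
Proof.
elim=> [|||||p IHp q IHq|p IHp q IHq|p IHp q IHq|p IHp];
  case=> [|||||p' q'|p' q'|p' q'|p'] //= /npair_inj[] //.
- by move=> _ /npair_inj[/IHp-> /IHq->].
- by move=> _ /npair_inj[/IHp-> /IHq->].
- by move=> _ /npair_inj[/IHp-> /IHq->].
- by move=> _ /IHp->.
Qed.

Lemma gn_PRec_inv R p q : gn R = npair 7 (npair p q) ->
  exists P Q, [/\ R = PRec P Q, gn P = p & gn Q = q].
Proof.
case: R => [|||||P Q|P Q|P Q|P] /= /npair_inj[] // _ /npair_inj[eP eQ].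
by exists P, Q.
Qed.

Section Certificates.

Variables (S : nat -> Prop) (O : nat -> bool).
Hypothesis OP : forall n, reflect (S n) (O n).

(** Induction on the list: the tail is again valid, and the first judgement appeals to the tail
    only. *)
Lemma valid_sound s : valid O s ->
  (forall p n y, evj p n y \in s -> exists2 P, gn P = p & eval S P n y) /\
  (forall p, wfj p \in s -> exists P, gn P = p).
Proof.
elim: s => // j s IH /= /andP[just_j /IH[IHe IHw]]; split.
- move=> p n y; rewrite inE => /orP[/eqP ej|]; last exact: IHe.
  move: just_j; rewrite /justified -ej jout_evj !npairE /= orbF /ev_step.
  move: (npair_fst_snd p) (npair_fst_snd (nsnd p)).
  move: (nfst p) (nsnd p) => t c ep ec.
  case/or4P => [|||/or4P[|||/or4P[]]].
  + case/and3P=> /eqP et /eqP e0 /eqP->.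
    by exists PZero; [rewrite -ep et e0 | constructor].
  + case/and3P=> /eqP et /eqP e0 /eqP->.
    by exists PSucc; [rewrite -ep et e0 | constructor].
  + case/and3P=> /eqP et /eqP e0 /eqP->.
    by exists PFst; [rewrite -ep et e0 | constructor].
  + case/and3P=> /eqP et /eqP e0 /eqP->.
    by exists PSnd; [rewrite -ep et e0 | constructor].
  + case/and3P=> /eqP et /eqP e0 /eqP->.
    exists POracle; first by rewrite -ep et e0.
    by case: OP => Sn; [apply: EOracle1 | apply: EOracle0].
  + case/and3P=> /eqP et /IHe[P eP evP] /IHe[Q eQ evQ].
    exists (PPair P Q); first by rewrite /= eP eQ ec -ep et.
    by rewrite -(npair_fst_snd y); constructor.
  + case/andP=> /eqP et /hasP[k ks /andP[/eqP ek]].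
    move: ks; rewrite ek jout_evj => /IHe[Q eQ evQ] /IHe[P eP evP].
    exists (PComp P Q); first by rewrite /= eP eQ ec -ep et.
    exact: EComp evQ evP.
  + case/and4P=> /eqP et /eqP en /IHe[P eP evP] /IHw[Q eQ].
    exists (PRec P Q); first by rewrite /= eP eQ ec -ep et.
    by rewrite -(npair_fst_snd n) en; constructor.
  + case/and3P=> /eqP et n0 /hasP[k ks /andP[/eqP ek]].
    move: ks; rewrite ek jout_evj => /IHe[R eR evR] /IHe[Q eQ evQ].
    (* The previous value is certified for the number of the whole recursion; inverting [gn]
       recovers the program behind it. *)
    have [|P [Q' [eR' eP eQ']]] := @gn_PRec_inv R (nfst c) (nsnd c).
      by rewrite eR -ep et ec.
    have ? : Q' = Q by apply: gn_inj; rewrite eQ' eQ.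
    subst Q' R; exists (PRec P Q) => //.
    move: evR evQ n0 (npair_fst_snd n) {ek}.
    move: (nfst n) (nsnd n) => a' [|m] //= evR evQ _ <-; exact: ERecS evR evQ.
  + case/and3P=> /eqP et /IHe[P eP evP] /allP evk.
    exists (PMu P); first by rewrite /= eP -ep et.
    have {}evk k : k < y -> exists z, eval S P (npair n k) z.+1.
      move=> lt_ky; move: (evk k); rewrite mem_iota => /(_ lt_ky)/hasP[j' j's].
      case/andP=> /eqP ej'.
      move: j's; rewrite ej' jout_evj => /IHe[P' eP' evP'].
      have ? : P' = P by apply: gn_inj; rewrite eP' eP.
      by subst P'; case: (jout j') evP' => // z evz _; exists z.
    (* [EMu] asks for a function of predecessors; it is chosen from the certified nonzero values,
       with the arbitrary value 0 from [y] on. *)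
    pose r k := if excluded_middle_informative (k < y) is left lt_ky
                then projT1 (constructive_indefinite_description _ (evk k lt_ky))
                else 0.
    apply: (EMu (r := r)) evP => k lt_ky; rewrite /r.
    case: excluded_middle_informative => // lt'.
    by case: constructive_indefinite_description.
- move=> p; rewrite inE => /orP[/eqP ej|]; last exact: IHw.
  move: just_j; rewrite /justified -ej /wfj !npairE /= /wf_step.
  move: (npair_fst_snd p) (npair_fst_snd (nsnd p)).
  move: (nfst p) (nsnd p) => t c ep ec; case/or3P.
  + case/andP=> lt_t /eqP c0; rewrite c0 in ep.
    case: t ep lt_t => [|[|[|[|[|]]]]] // <- _.
    * by exists PZero.
    * by exists PSucc.
    * by exists PFst.
    * by exists PSnd.
    * by exists POracle.
  + case/and4P=> gt_t lt_t /IHw[P eP] /IHw[Q eQ].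
    rewrite -ec -eP -eQ in ep.
    case: t ep gt_t lt_t => [|[|[|[|[|[|[|[|]]]]]]]] // <- _ _.
    * by exists (PPair P Q).
    * by exists (PComp P Q).
    * by exists (PRec P Q).
  + by case/andP=> /eqP et /IHw[P eP]; exists (PMu P); rewrite /= eP -ep et.
Qed.

End Certificates.

Lemma has_mono (P P' : pred nat) s s' :
  {subset s <= s'} -> (forall j, P j -> P' j) -> has P s -> has P' s'.
Proof. by move=> ss' PP' /hasP[j /ss' js' /PP' Pj]; apply/hasP; exists j. Qed.

Lemma orb_mono (a a' b b' : bool) :
  (a -> a') -> (b -> b') -> a || b -> a' || b'.
Proof. by case: a => [->|_] // bb' /bb' ->; rewrite orbT. Qed.

Lemma andb_mono (a a' b b' : bool) :
  (a -> a') -> (b -> b') -> a && b -> a' && b'.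
Proof. by move=> aa' bb' /andP[/aa'-> /bb'->]. Qed.

(** Membership in [s] occurs only positively in the rules. *)
Lemma justified_mono O j s s' :
  {subset s <= s'} -> justified O j s -> justified O j s'.
Proof.
move=> ss'; rewrite /justified /ev_step /wf_step.
repeat first [exact: ss' | apply: orb_mono => // | apply: andb_mono => //
  | apply: has_mono => // ? | by []
  | by move=> /allP h; apply/allP => k /h; apply: has_mono].
Qed.

(** Judgements of [s] keep their justifications in the longer tails, and those of [s'] have the same
    tails as before. *)
Lemma valid_cat O s s' : valid O s -> valid O s' -> valid O (s ++ s').
Proof.
move=> vs vs'; elim: s vs => //= j s IH /andP[just_j /IH vss'].
apply/andP; split=> //; apply: justified_mono just_j => x.
by rewrite mem_cat => ->.
Qed.

Section Completeness.

Variables (S : nat -> Prop) (O : nat -> bool).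
Hypothesis OP : forall n, reflect (S n) (O n).

Lemma valid_ev_step s p n y : valid O s -> ev_step O p n y s ->
  exists2 s', valid O s' & evj p n y \in s'.
Proof.
move=> vs ps; exists (evj p n y :: s); last exact: mem_head.
apply/andP; split=> //.
by rewrite /justified jout_evj /evj !npairE ps.
Qed.

Lemma valid_wf_step s p : valid O s -> wf_step p s ->
  exists2 s', valid O s' & wfj p \in s'.
Proof.
move=> vs ps; exists (wfj p :: s); last exact: mem_head.
by apply/andP; split=> //; rewrite /justified /wfj !npairE ps.
Qed.

Lemma valid_wf P : exists2 s, valid O s & wfj (gn P) \in s.
Proof.
have binary t p q : 4 < t < 8 ->
    (exists2 s, valid O s & wfj p \in s) ->
    (exists2 s, valid O s & wfj q \in s) ->
    exists2 s, valid O s & wfj (npair t (npair p q)) \in s.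
  case/andP=> gt_t lt_t [s vs ps] [s' vs' qs'].
  apply: (valid_wf_step (valid_cat vs vs')).
  by rewrite /wf_step !npairE gt_t lt_t !mem_cat ps qs' !orbT.
elim: P => [|||||p IHp q IHq|p IHp q IHq|p IHp q IHq|p [s vs ps]];
  try by apply: (@valid_wf_step [::]); rewrite // /wf_step !npairE.
- exact: (binary 5).
- exact: (binary 6).
- exact: (binary 7).
- by apply: (valid_wf_step vs); rewrite /wf_step !npairE ps !orbT.
Qed.

Lemma valid_complete P n y :
  eval S P n y -> exists2 s, valid O s & evj (gn P) n y \in s.
Proof.
elim=> {P n y}.
- by move=> n; apply: (@valid_ev_step [::]); rewrite // /ev_step !npairE !eqxx.
- by move=> n; apply: (@valid_ev_step [::]); rewrite // /ev_step !npairE !eqxx.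
- by move=> n; apply: (@valid_ev_step [::]); rewrite // /ev_step !npairE !eqxx.
- by move=> n; apply: (@valid_ev_step [::]); rewrite // /ev_step !npairE !eqxx.
- move=> n /OP On; apply: (@valid_ev_step [::]) => //.
  by rewrite /ev_step !npairE On !eqxx.
- move=> n /OP On; apply: (@valid_ev_step [::]) => //.
  by rewrite /ev_step !npairE (negPf On) !eqxx.
- move=> p q n x y _ [s vs xs] _ [s' vs' ys'].
  apply: (valid_ev_step (valid_cat vs vs')).
  by rewrite /ev_step !npairE !mem_cat xs ys' !orbT.
- move=> p q n x y _ [s vs xs] _ [s' vs' ys'].
  apply: (valid_ev_step (valid_cat vs vs')); rewrite /ev_step !npairE.
  (* The seventh disjunct of [ev_step] is the rule for composition. *)
  apply/or4P/Or44/or4P/Or44/or4P/Or41/andP; split=> //; apply/hasP.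
  exists (evj (gn q) n x); first by rewrite mem_cat xs.
  by rewrite jout_evj eqxx mem_cat ys' orbT.
- move=> p q a x _ [s vs xs]; have [s' vs' qs'] := valid_wf q.
  apply: (valid_ev_step (valid_cat vs vs')).
  by rewrite /ev_step !npairE !mem_cat xs qs' !orbT.
- move=> p q a n x y _ [s vs xs] _ [s' vs' ys'].
  apply: (valid_ev_step (valid_cat vs vs')); rewrite /ev_step !npairE.
  apply/or4P/Or44/or4P/Or44/or4P/Or43/and3P; split=> //; apply/hasP.
  exists (evj (gn (PRec p q)) (npair a n) x); first by rewrite mem_cat xs.
  by rewrite jout_evj eqxx mem_cat ys' orbT.
- move=> p a n r _ IHr _ [s vs s0].
  (* The certificates for the finitely many [k < n] are concatenated. *)
  have [s' vs' rs'] : exists2 s', valid O s' &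
      forall k, k < n -> evj (gn p) (npair a k) (r k).+1 \in s'.
    elim: n IHr {s0} => [|n IHn] IHr; first by exists [::].
    have [k lt_kn|s1 vs1 rs1] := IHn; first exact/IHr/ltnW.
    have [s2 vs2 rs2] := IHr n (ltnSn n).
    exists (s1 ++ s2); first exact: valid_cat.
    move=> k; rewrite ltnS leq_eqVlt mem_cat => /predU1P[->|/rs1->] //.
    by rewrite rs2 orbT.
  apply: (valid_ev_step (valid_cat vs vs')); rewrite /ev_step !npairE.
  apply/or4P/Or44/or4P/Or44/or4P/Or44/and3P; split=> //.
    by rewrite mem_cat s0.
  apply/allP => k; rewrite mem_iota => /rs' ks'; apply/hasP.
  exists (evj (gn p) (npair a k) (r k).+1); last by rewrite jout_evj eqxx.
  by rewrite mem_cat ks' orbT.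
Qed.

End Completeness.

(** Evaluation thus becomes the existence of a number that passes a test computable in the
    oracle. *)
Lemma eval_valid S O P n y : (forall n, reflect (S n) (O n)) ->
  eval S P n y <-> exists2 s, valid O s & evj (gn P) n y \in s.
Proof.
move=> OP; split; first exact: valid_complete.
case=> s /(valid_sound OP)[+ _] => /[apply] -[Q /gn_inj->].
by [].
Qed.

(** * The second jump as a Sigma_2 set *)

(** The stage bounds the code of the certificate, so this approximation to the halting set is
    decidable and grows with [s]. *)
Definition halted s x :=
  has (fun w => valid (fun=> false) (decode w) && has_ev x x (decode w))
    (iota 0 s).

Lemma halted_mono s s' x : s <= s' -> halted s x -> halted s' x.
Proof.
move=> le_ss'; apply: has_mono => // w; rewrite !mem_iota => lt_ws.
exact: leq_trans le_ss'.
Qed.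

Lemma jump_halted x : jump no_oracle x <-> exists s, halted s x.
Proof.
have noP n : reflect (no_oracle n) false by apply: ReflectF.
split=> [[P [y [<- /(eval_valid _ _ _ noP)[s vs ys]]]] | [s /hasP[w _]]].
  exists (scode s).+1; apply/hasP; exists (scode s); first by rewrite mem_iota /=.
  by rewrite scodeK vs; apply/has_evP; exists y.
case/andP=> vw /has_evP[y yw].
have [/(_ _ _ _ yw)[P eP evP] _] := valid_sound noP vw.
by exists P, y.
Qed.

(* [i] codes a certificate for the halting of [e] relative to the halting set,
   the latter being replaced by its approximation at a stage [s]; it is
   refuted once a number that the certificate may have queried halts after
   stage [s]. *)
Definition refuted2 e i t :=
  ~~ (valid (halted (nsnd i)) (decode (nfst i)) &&
      has_ev e e (decode (nfst i))) ||
  has (fun x => halted t x && ~~ halted (nsnd i) x) (iota 0 (nfst i)).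

(** A halting computation relative to the halting set yields a certificate, and a stage at which the
    halting set has settled below its code makes the pair an unrefuted candidate. Conversely, the
    stage of an unrefuted candidate answers all queries of its certificate correctly. *)
Lemma jump2_refuted e :
  jump (jump no_oracle) e <-> exists i, forall t, ~~ refuted2 e i t.
Proof.
have KP n : reflect (jump no_oracle n) (decide (jump no_oracle n)).
  exact: decideP.
(* If no number below the code halts after the stage, the approximation and the halting set agree on
   all possible queries. *)
have agree i : (forall t x, x < nfst i -> halted t x -> halted (nsnd i) x) ->
    valid (halted (nsnd i)) (decode (nfst i)) =
    valid (fun n => decide (jump no_oracle n)) (decode (nfst i)).
  move=> stable; apply: valid_ext => x; rewrite decodeK => lt_x.
  apply/idP/KP => [hx | /jump_halted[t /stable]]; last exact.
  by apply/jump_halted; exists (nsnd i).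
split=> [[P [y [<- /(eval_valid _ _ _ KP)[s vs ys]]]] | [i]].
  have [b hb] : exists b, forall x, x < scode s -> jump no_oracle x -> halted b x.
    elim: (scode s) => [|n [b hb]]; first by exists 0.
    have [Kn|nKn] := classic (jump no_oracle n); last first.
      by exists b => x; rewrite ltnS leq_eqVlt => /predU1P[->|/hb].
    have [b' hb'] := (jump_halted n).1 Kn.
    exists (maxn b b') => x; rewrite ltnS leq_eqVlt => /predU1P[->|lt_x] Kx.
      exact: halted_mono (leq_maxr _ _) hb'.
    exact: halted_mono (leq_maxl _ _) (hb x lt_x Kx).
  exists (npair (scode s) b) => t; rewrite /refuted2 negb_or negbK npairE.
  have stable t' x : x < scode s -> halted t' x -> halted b x.
    by move=> lt_x ht; apply: hb => //; apply/jump_halted; exists t'.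
  have := agree (npair (scode s) b); rewrite !npairE => -> //.
  rewrite scodeK vs; apply/andP; split; first by apply/has_evP; exists y.
  apply/hasPn => x; rewrite mem_iota => /stable stx.
  by rewrite negb_and negbK -implybE; apply/implyP => /stx.
(* The validity part of [refuted2] does not depend on the stage, so stage 0 suffices to extract
   it. *)
move=> nref; have/norP[] := nref 0; rewrite negbK => /andP[].
rewrite agree => [vi /has_evP[y yi] _|t x lt_x ht].
  have [/(_ _ _ _ yi)[P eP evP] _] := valid_sound KP vi.
  by exists P, y.
have/norP[_ /hasPn/(_ x)] := nref t; rewrite mem_iota ht /= negbK.
exact.
Qed.

(* Instance [(0, e)] asks for [e] in the second jump, and instance [(1, (e, i))]
   for a refutation of [i]. *)
Definition refuted z i t :=
  (nfst z == 0) && refuted2 (nsnd z) i t ||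
  (nfst z != 0) && ~~ refuted2 (nfst (nsnd z)) (nsnd (nsnd z)) i.

Lemma refuted2_mono e i t t' : t <= t' -> refuted2 e i t -> refuted2 e i t'.
Proof.
move=> le_tt'; apply: orb_mono => //; apply: has_mono => // x.
by apply: andb_mono => //; apply: halted_mono.
Qed.

Lemma refuted_mono z i t t' : t <= t' -> refuted z i t -> refuted z i t'.
Proof.
move=> le_tt'; apply: orb_mono => //; apply: andb_mono => //.
exact: refuted2_mono.
Qed.

Lemma computable_refuted2 S e i t :
  computable_in S e -> computable_in S i -> computable_in S t ->
  computable_in S (fun n => refuted2 (e n) (i n) (t n)).
Proof.
have comp_halted s x : computable_in S s -> computable_in S x ->
    computable_in S (fun n => halted (s n) (x n)).
  apply: (comp_comp2 (F := halted)); rewrite /halted /has_ev /evj /jout.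
  comp_tac; apply: (computable_valid (O := fun _ _ => false)); comp_tac.
move=> ce ci ct; apply: (comp_comp3 (F := refuted2)) => // {e i t ce ci ct}.
rewrite /refuted2 /has_ev /evj /jout.
comp_tac; try by apply: comp_halted; comp_tac.
apply: (computable_valid (O := fun n => halted (nsnd (nfst (nsnd n)))));
  last by comp_tac.
by apply: comp_halted; comp_tac.
Qed.

Lemma computable_refuted S z i t :
  computable_in S z -> computable_in S i -> computable_in S t ->
  computable_in S (fun n => refuted (z n) (i n) (t n)).
Proof.
move=> cz ci ct; rewrite /refuted; comp_tac;
  by apply: computable_refuted2; comp_tac.
Qed.

Definition unrefuted z i := forall t, ~~ refuted z i t.

(** [h] bounds both quantifiers in the question whether some candidate is never refuted: instance
    [(0, e)] bounds the candidate, and instance [(1, (e, i))] bounds the stage of a refutation of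
    [i]. The successors include the bounds themselves. *)
Lemma bound_decides_jump2 S h : computable_in S h ->
  (forall z, (exists i, unrefuted z i) -> exists2 i, i <= h z & unrefuted z i) ->
  turing_le (jump (jump no_oracle)) S.
Proof.
move=> ch hP.
pose refutable e i :=
  has (fun t => refuted2 e i t) (iota 0 (h (npair 1 (npair e i))).+1).
pose d e := has (fun i => ~~ refutable e i) (iota 0 (h (npair 0 e)).+1).
have refutableP e i : reflect (exists t, refuted2 e i t) (refutable e i).
  apply: (iffP hasP) => [[t _ ref_t] | ex_t]; first by exists t.
  have [|t le_th unref_t] := hP (npair 1 (npair e i)).
    by case: ex_t => t ref_t; exists t => u; rewrite /refuted !npairE /= negbK.
  exists t; first by rewrite mem_iota.
  by have := unref_t 0; rewrite /refuted !npairE /= negbK.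
have dP e : reflect (jump (jump no_oracle) e) (d e).
  apply: (iffP hasP) => [[i _ /refutableP nref] | /jump2_refuted ex_i].
    apply/jump2_refuted; exists i => t; apply/negP => ref_t.
    by apply: nref; exists t.
  have [|i le_ih unref_i] := hP (npair 0 e).
    by case: ex_i => i nref; exists i => t; rewrite /refuted !npairE /= orbF.
  exists i; first by rewrite mem_iota.
  apply/refutableP => -[t ref_t].
  by have := unref_i t; rewrite /refuted !npairE /= ref_t.
have [p dp] : computable_in S (fun e => d e).
  rewrite /d /refutable; comp_tac.
  - by apply: computable_refuted2; comp_tac.
  - by apply: (comp_comp ch); comp_tac.
  - by apply: (comp_comp ch); comp_tac.
exists p => e; have := dp e; case: (dP e) => e2 de; split=> //.
Qed.

(** * The language and the structure *)

Lemma graph_ar_computable :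
  computable_in no_oracle (fun n => if n is 0 then 2 else 1).
Proof.
by apply: (comp_ext (f := fun n => (n == 0).+1)) => [[]|]; comp_tac.
Qed.

(* Symbol [0] is the edge relation; symbol [l.+1] says that a point has
   label [l]. *)
Definition graph_lang : language.
Proof.
apply: (@Language xpredT xpred0 (fun n => if n is 0 then 2 else 1)).
- by [].
- by case.
- exact: comp_const.
- exact: comp_const.
- by have [p pP] := graph_ar_computable; exists p => n _.
Defined.

Definition graph_rel T (lab : T -> nat) (E : T -> T -> Prop) n (xs : seq T) :=
  match n, xs with
  | 0, [:: x; y] => E x y
  | l.+1, [:: x] => lab x = l
  | _, _ => False
  end.

Definition graph_interp T lab E : interp graph_lang T :=
  Interp (fun (r : rel_sym graph_lang) xs => graph_rel lab E (val r) xs)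
         (fun g _ => False_rect T (Bool.diff_false_true (valP g))).

Definition graph T lab E : structure graph_lang :=
  Structure (@graph_interp T lab E).

(** Each point carries exactly one label, which is not so in every structure of this language. *)
Definition is_graph (A : structure graph_lang) lab E :=
  forall r xs, Defs.rel A r xs <-> @graph_rel A lab E (val r) xs.
Arguments is_graph : clear implicits.

Lemma graph_rel_map T U (f : T -> U) lab E n xs :
  graph_rel lab E n (map f xs) <->
  graph_rel (lab \o f) (fun x y => E (f x) (f y)) n xs.
Proof. by case: n xs => [|n] [|x [|y []]]. Qed.

Definition symb n : rel_sym graph_lang := exist _ n isT.

Definition gembedding T U labT (ET : T -> T -> Prop) labU
    (EU : U -> U -> Prop) (f : T -> U) : Prop :=
  [/\ injective f, forall x, labU (f x) = labT x :> nat
    & forall x y, EU (f x) (f y) <-> ET x y].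

Lemma graph_embedding (A B : structure graph_lang) labA EA labB EB (f : A -> B) :
  is_graph A labA EA -> is_graph B labB EB ->
  embedding f <-> gembedding labA EA labB EB f.
Proof.
move=> gA gB; split=> [[f_inj f_rel _] | [f_inj f_lab f_edge]].
  split=> // [x|x y].
    have := f_rel (symb (labA x).+1) [tuple x].
    by rewrite gA gB /= => -[->].
  have := f_rel (symb 0) [tuple x; y].
  by rewrite gA gB /=; tauto.
split=> // [r xs | [] //].
rewrite gA gB /= graph_rel_map; move: (sval r) (tval xs) => n s.
by case: n s => [|n] [|x [|y []]] //=; rewrite ?f_edge ?f_lab.
Qed.

(* A label [(0, z)] marks a root that stands for the instance [z], and a label
   [(k, i)] with [k != 0] marks a leaf that stands for the candidate [i]. *)
Definition live T (lab : T -> nat) x y :=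
  unrefuted (nsnd (lab x)) (nsnd (lab y)).

Definition good T (lab : T -> nat) (E : T -> T -> Prop) :=
  (forall x y, E x y -> nfst (lab x) = 0 /\ nfst (lab y) <> 0) /\
  (forall x y z, E x y -> E x z -> live lab x y -> live lab x z ->
     lab y = lab z).

(** Within the class this turns out to characterize the amalgamation bases. *)
Definition based T (lab : T -> nat) (E : T -> T -> Prop) :=
  forall x i, nfst (lab x) = 0 -> unrefuted (nsnd (lab x)) i ->
    exists2 y, E x y & live lab x y.

(** A number, viewed as an element, codes its label, a name that keeps equally labelled points
    apart, a stage, a marked label and a list of potential children. *)
Definition mlab x := nfst x.
Definition mstage x := nfst (nsnd (nsnd x)).
Definition mmark x := nfst (nsnd (nsnd (nsnd x))).
Definition mchildren x := nsnd (nsnd (nsnd (nsnd x))).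

(* A live child must have the label marked by its parent, so that two live
   children never have distinct labels. *)
Definition medge x y :=
  [&& nfst (mlab x) == 0, nfst (mlab y) != 0, y \in decode (mchildren x)
    & (mlab y == mmark x) ||
      refuted (nsnd (mlab x)) (nsnd (mlab y)) (mstage x)].

Lemma medge_good (P : pred nat) :
  good (fun x : {n | P n} => mlab (sval x))
       (fun x y => medge (sval x) (sval y)).
Proof.
split=> [x y | x y z].
  by case/and4P=> /eqP-> /eqP.
rewrite /live; case/and4P=> _ _ _ xy; case/and4P=> _ _ _ xz uxy uxz.
by move: xy xz; rewrite (negPf (uxy _)) (negPf (uxz _)) !orbF => /eqP-> /eqP->.
Qed.

(** Without function symbols every set of numbers carries a substructure. *)
Definition msub (P : pred nat) : nstructure graph_lang :=
  @NStructure graph_lang P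
    (graph_interp (fun x : {n | P n} => mlab (sval x))
                  (fun x y => medge (sval x) (sval y))).

Lemma is_graph_msub P :
  is_graph (msub P) (fun x => mlab (sval x)) (fun x y => medge (sval x) (sval y)).
Proof. by []. Qed.

(** The first component of [i] codes a tuple; the second is a counter that makes every tuple occur
    infinitely often. *)
Definition tuple_str i := msub (fun n => n \in decode (nfst i)).

Definition Kage (A : structure graph_lang) : Prop :=
  exists i, isomorphic A (tuple_str i).

(** * Finite graphs as members of the age *)

Definition finite T := exists s : seq T, forall x, List.In x s.

Lemma finite_sum T U : finite T -> finite U -> finite (T + U).
Proof.
move=> [s sT] [s' s'U]; exists (List.map inl s ++ List.map inr s') => -[x|x].
  by apply/List.in_or_app; left; apply: List.in_map.
by apply/List.in_or_app; right; apply: List.in_map.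
Qed.

Lemma finite_sig T (P : pred T) : finite T -> finite {x | P x}.
Proof.
case=> s sT; suff [s' s'P] : exists s' : seq {x | P x},
    forall u, List.In (sval u) s -> List.In u s'.
  by exists s' => u; apply: s'P.
elim: s {sT} => [|a s [s' s's]]; first by exists [::].
have [Pa|nPa] := boolP (P a).
  exists (exist _ a Pa :: s') => u /= [eu | /s's]; last by right.
  by left; apply: val_inj.
exists s' => -[x Px] /= [eu | /(s's (exist _ x Px))] //.
by rewrite eu Px in nPa.
Qed.

Lemma seq_image T (P : T -> Prop) (f : T -> nat) : finite T ->
  exists c : seq nat, forall n, (n \in c) <-> exists2 y, P y & n = f y.
Proof.
case=> s sT; suff [c cP] : exists c : seq nat, forall n,
    (n \in c) <-> exists2 y, P y /\ List.In y s & n = f y.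
  by exists c => n; rewrite cP; split=> -[y]; [case; exists y | exists y].
elim: s {sT} => [|a s [c cP]].
  by exists [::] => n; split=> // -[y []].
have [Pa|nPa] := classic (P a).
  exists (f a :: c) => n; rewrite inE; split.
    case/predU1P=> [->|/cP[y [Py ys] ->]]; first by exists a; rewrite //=; auto.
    by exists y; rewrite //=; auto.
  case=> y [Py /= [<- | ys]] ->; first by rewrite eqxx.
  by apply/orP; right; apply/cP; exists y.
exists c => n; rewrite cP; split=> -[y [Py ys] ->]; exists y => //=; first by auto.
by case: ys Py nPa => // ->.
Qed.

Lemma stage_bound T (P : T -> Prop) (Q : T -> nat -> Prop) : finite T ->
  (forall y t t', t <= t' -> Q y t -> Q y t') ->
  (forall y, P y -> exists t, Q y t) -> exists t, forall y, P y -> Q y t.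
Proof.
move=> [s sT] Qmono PQ.
suff [t tP] : exists t, forall y, List.In y s -> P y -> Q y t.
  by exists t => y; apply: tP.
elim: s {sT} => [|a s [t tP]]; first by exists 0.
have [/PQ[t' Qt']|nPa] := classic (P a); last first.
  by exists t => y /= [<-|/tP].
exists (maxn t t') => y /= [<- _ | ys Py].
  exact: Qmono (leq_maxr _ _) Qt'.
by apply: Qmono (leq_maxl _ _) _; apply: tP.
Qed.

Lemma finite_index T : finite T -> exists idx : T -> nat, injective idx.
Proof.
case=> s sT; have /choice[idx idxP] x := List.In_nth_error s x (sT x).
by exists idx => x y exy; move: (idxP x); rewrite exy idxP => -[].
Qed.

(** Leaves are numbered first, with 0 as their last component. The number of a root can then list
    its children, mark the common label of the live ones, and name a stage by which all the others
    are refuted. *)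
Lemma graph_Kage (A : structure graph_lang) lab E :
  is_graph A lab E -> good lab E -> finite A -> Kage A.
Proof.
move=> gA [bip coh] finA.
have [idx idx_inj] := finite_index finA.
pose point x w := npair (lab x) (npair (idx x) w).
have /choice[w wP] x : exists w, forall y, nfst (lab y) <> 0 ->
    medge (point x w) (point y 0) <-> E x y.
  have [c cP] := seq_image (E x) (point^~ 0) finA.
  have [t tP] : exists t, forall y, (E x y /\ ~ live lab x y) ->
      refuted (nsnd (lab x)) (nsnd (lab y)) t.
    apply: stage_bound => // [y t t'|y [_ /not_all_ex_not[t /negP]]].
      exact: refuted_mono.
    by rewrite negbK; exists t.
  (* Coherence makes the label of the live children unique; a root without live children gets the
     arbitrary mark 0. *)
  have [d dP] : exists d, forall y, E x y -> live lab x y -> lab y = d.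
    have [[y [Exy lxy]]|nex] := classic (exists y, E x y /\ live lab x y).
      by exists (lab y) => z Exz lxz; apply: (coh x).
    by exists 0 => y Exy lxy; case: nex; exists y.
  exists (npair t (npair d (scode c))) => y leaf_y.
  rewrite /medge /mlab /mmark /mchildren /mstage /point !npairE scodeK.
  split=> [/and4P[_ _ /cP[y' Exy'] + _]|Exy].
    by case/npair_inj=> _ /npair_inj[/idx_inj->].
  have [/eqP-> /eqP->] := bip _ _ Exy.
  rewrite /=; apply/andP; split; first by apply/cP; exists y.
  have [lxy|nlxy] := classic (live lab x y); first by rewrite (dP y) ?eqxx.
  by rewrite tP ?orbT.
(* Leaves keep the last component 0 under which the roots list them. *)
pose g x := point x (if nfst (lab x) == 0 then w x else 0).
have [c cP] := seq_image (fun=> True) g finA.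
have g_in x : g x \in decode (nfst (npair (scode c) 0)).
  by rewrite npairE scodeK; apply/cP; exists x.
exists (npair (scode c) 0), (fun x => exist _ (g x) (g_in x)); split.
  apply/(graph_embedding _ gA (@is_graph_msub _)); split=> /= [x y|x|x y].
  - by case=> /npair_inj[_ /npair_inj[/idx_inj]].
  - by rewrite /mlab npairE.
  - have [root_x|nroot_x] := eqVneq (nfst (lab x)) 0; last first.
      split=> [/and4P[]|/bip[/eqP]]; last by rewrite (negPf nroot_x).
      by rewrite /mlab npairE (negPf nroot_x).
    have [root_y|nroot_y] := eqVneq (nfst (lab y)) 0.
      split=> [/and4P[_]|/bip[_]]; last by rewrite root_y.
      by rewrite /mlab npairE root_y.
    by rewrite /g root_x eqxx (negPf nroot_y); apply: wP; apply/eqP.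
move=> [n n_in]; have [x _ en] : exists2 x, True & n = g x.
  by apply/cP; move: n_in; rewrite /= npairE scodeK.
by exists x; apply: val_inj; rewrite /= en.
Qed.

Lemma Kage_graph A : Kage A ->
  exists lab E, [/\ is_graph A lab E, good lab E & finite A].
Proof.
case=> i [f [[f_inj f_rel _] _]].
have [bip coh] := medge_good (fun n => n \in decode (nfst i)).
exists (fun x => mlab (sval (f x))), (fun x y => medge (sval (f x)) (sval (f y))).
split.
- by move=> r xs; rewrite f_rel; apply: graph_rel_map.
- by split=> [x y /bip | x y z]; last apply: coh.
- have [s sP] : exists s : seq A, forall n x, n \in decode (nfst i) ->
      sval (f x) = n -> List.In x s.
    elim: (decode _) => [|n c [s sP]]; first by exists [::].
    have [[a fa]|nex] := classic (exists a, sval (f a) = n).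
      exists (a :: s) => m x; rewrite inE => /predU1P[->|mc] fx /=; last first.
        by right; apply: sP mc fx.
      by left; apply: f_inj; apply: val_inj; rewrite /= fa fx.
    exists s => m x; rewrite inE => /predU1P[->|mc] fx; last exact: sP mc fx.
    by case: nex; exists x.
  by exists s => x; apply: sP (svalP (f x)) _.
Qed.

(** * Cofinal amalgamation *)

Lemma graph_is_graph T lab E : is_graph (@graph T lab E) lab E.
Proof. by []. Qed.

(** A clash could arise only at a root from [A] with a live child in [B] and another in [C]. As [A]
    is based, this root has a live child in [A] already, and coherence in [B] and in [C] gives both
    children its label. *)
Lemma free_amalgam A B C labA EA labB EB labC EC (f : A -> B) (g : A -> C) :
  based labA EA -> gembedding labA EA labB EB f ->
  gembedding labA EA labC EC g -> good labB EB -> good labC EC ->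
  finite B -> finite C ->
  exists D labD ED (i : B -> D) (j : C -> D),
    [/\ good labD ED, finite D, gembedding labB EB labD ED i,
        gembedding labC EC labD ED j & forall x, i (f x) = j (g x)].
Proof.
move=> basedA [f_inj f_lab f_edge] [g_inj g_lab g_edge] [bipB cohB] [bipC cohC].
move=> finB finC.
pose D := (B + {c : C | ~~ decide (exists a, c = g a)})%type.
pose i : B -> D := inl.
(* [j] sends [g a] to [f a] and every other point of [C] to its own copy. *)
have /choice[j jP] c : exists d : D,
    (exists2 a, c = g a & d = inl (f a)) \/ (exists nc, d = inr (exist _ c nc)).
  have [[a ca]|nc] := classic (exists a, c = g a).
    by exists (inl (f a)); left; exists a.
  have {}nc : ~~ decide (exists a, c = g a) by apply/decideP.
  by exists (inr (exist _ c nc)); right; exists nc.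
have jg a : j (g a) = i (f a).
  case: (jP (g a)) => [[a' /g_inj-> //] | [nc _]].
  by case/decideP: nc; exists a.
have ji c b : j c = i b -> exists2 a, c = g a & b = f a.
  by case: (jP c) => [[a -> ->] [<-] | [nc ->]] //; exists a.
have j_inj : injective j.
  move=> c c'; case: (jP c') => [[a' -> ->] /ji[a -> /f_inj->] // | [nc' ->]].
  by case: (jP c) => [[a _ ->] | [nc ->] [->]].
pose labD (d : D) := match d with inl b => labB b | inr c => labC (val c) end.
pose ED d d' := (exists b b', [/\ d = i b, d' = i b' & EB b b']) \/
                (exists c c', [/\ d = j c, d' = j c' & EC c c']).
have j_lab c : labD (j c) = labC c.
  by case: (jP c) => [[a -> ->] | [nc ->]] //=; rewrite f_lab g_lab.
(* An edge of [C] between points of [B] has both ends in [A], hence is already an edge of [A] and of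
   [B]. *)
have i_edge b b' : ED (i b) (i b') <-> EB b b'.
  split; last by left; exists b, b'.
  case=> [[_ [_ [[<-] [<-] //]]] | [c [c' [/esym/ji[a -> ->] /esym/ji[a' -> ->]]]]].
  by rewrite g_edge f_edge.
have j_edge c c' : ED (j c) (j c') <-> EC c c'.
  split; last by right; exists c, c'.
  case=> [[_ [_ [/ji[a -> ->] /ji[a' -> ->]]]] | [_ [_ [/j_inj<- /j_inj<- //]]]].
  by rewrite g_edge f_edge.
exists D, labD, ED, i, j.
have emb_i : gembedding labB EB labD ED i by split=> // b b' [].
have finD : finite D by apply: finite_sum finB (finite_sig _ finC).
suff: good labD ED by split.
split=> [_ _ [[b [b' [-> -> /bipB]]] | [c [c' [-> -> /bipC]]]]|] //.
  by rewrite !j_lab.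
have mixed b b' c c' : i b = j c -> EB b b' -> EC c c' ->
    live labB b b' -> live labC c c' -> labB b' = labC c'.
  move=> /esym/ji[a -> ->] Eb Ec lb lc.
  have [root_a _] := bipB _ _ Eb; rewrite f_lab in root_a.
  have la : unrefuted (nsnd (labA a)) (nsnd (labB b')) by rewrite -f_lab.
  have [a' Ea la'] := basedA a _ root_a la.
  rewrite (cohB (f a) b' (f a')) ?f_edge // ?(cohC (g a) c' (g a')) ?g_edge //.
  - by rewrite f_lab g_lab.
  - by rewrite /live !g_lab.
  - by rewrite /live !f_lab.
move=> x y z; rewrite /live.
case=> [[b [b' [-> -> Eb]]] | [c [c' [-> -> Ec]]]];
  case=> [[b1 [b2 [e1 -> E1]]] | [c1 [c2 [e1 -> E1]]]]; rewrite ?j_lab.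
- by case: e1 E1 => <-; apply: cohB.
- rewrite {2}e1 j_lab /= => lb lc; exact: (mixed _ _ _ _ e1).
- have lab_c : labC c = labB b1 by rewrite -j_lab e1.
  rewrite {2}lab_c /= => lc lb; apply/esym.
  by apply: (mixed _ _ _ _ (esym e1)) => //; rewrite /live.
- by case: e1 E1 => /j_inj<-; apply: cohC.
Qed.

Lemma based_amalgamation_base A lab E :
  is_graph A lab E -> Kage A -> based lab E -> amalgamation_base Kage A.
Proof.
move=> gA KA basedA; split=> // B C f g KB KC emb_f emb_g.
have [labB [EB [gB goodB finB]]] := Kage_graph KB.
have [labC [EC [gC goodC finC]]] := Kage_graph KC.
move/(graph_embedding _ gA gB): emb_f => emb_f.
move/(graph_embedding _ gA gC): emb_g => emb_g.
have [D [labD [ED [i [j [goodD finD emb_i emb_j ij]]]]]] :=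
  free_amalgam basedA emb_f emb_g goodB goodC finB finC.
exists (graph labD ED), i, j; split=> //.
- exact: graph_Kage (@graph_is_graph _ _ _) goodD finD.
- exact/(graph_embedding _ gB (@graph_is_graph _ _ _)).
- exact/(graph_embedding _ gC (@graph_is_graph _ _ _)).
Qed.

Section AttachLeaves.

Variables (A : structure graph_lang) (lab : A -> nat) (E : A -> A -> Prop).
Variables (P : pred A) (w : A -> nat).
Hypotheses (gA : is_graph A lab E) (goodA : good lab E) (finA : finite A).
Hypothesis w_leaf : forall x, P x -> nfst (lab x) = 0 /\ nfst (w x) <> 0.
Hypothesis no_live : forall x y, P x -> E x y -> ~ live lab x y.

Definition attach := (A + {x | P x})%type.

Definition attach_lab (u : attach) :=
  match u with inl x => lab x | inr x => w (val x) end.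

Definition attach_edge (u v : attach) :=
  match u, v with
  | inl x, inl y => E x y
  | inl x, inr y => x = val y
  | inr _, _ => False
  end.

Lemma attach_embedding :
  embedding (inl : A -> graph attach_lab attach_edge).
Proof.
apply/(graph_embedding _ gA (@graph_is_graph _ _ _)).
by split=> [x y []|x|x y].
Qed.

(** A point of [P] has no live child in [A] and receives a single new one, so no two live children
    can disagree. *)
Lemma attach_Kage : Kage (graph attach_lab attach_edge).
Proof.
have [bip coh] := goodA.
apply: graph_Kage (@graph_is_graph _ _ _) _ _;
  last exact: finite_sum finA (finite_sig _ finA).
split=> [[x|x] [y|y] //= | [x|x] [y|y] [z|z]] //=.
- exact: bip.
- by move=> ->; apply/w_leaf/valP.
- exact: coh.
- by move=> Exy ex lxy _; rewrite ex in Exy lxy; case: (no_live (valP z) Exy lxy).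
- by move=> ex Exz _ lxz; rewrite ex in Exz lxz; case: (no_live (valP y) Exz lxz).
- by move=> -> /val_inj ->.
Qed.

End AttachLeaves.

(** Every root that has an unrefuted candidate but no live child receives a leaf for such a
    candidate; the result is based. *)
Lemma Kage_CAP : CAP Kage.
Proof.
move=> A /Kage_graph[lab [E [gA goodA finA]]].
pose needs x := [/\ nfst (lab x) = 0, exists i, unrefuted (nsnd (lab x)) i
                  & ~ exists2 y, E x y & live lab x y].
have /choice[w wP] x : exists i, needs x -> unrefuted (nsnd (lab x)) i.
  have [[i ui]|nex] := classic (exists i, unrefuted (nsnd (lab x)) i).
    by exists i.
  by exists 0 => -[].
pose P x := decide (needs x); pose l x := npair 1 (w x).
have leafP x : P x -> nfst (lab x) = 0 /\ nfst (l x) <> 0.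
  by case/decideP=> root_x _ _; rewrite npairE.
have noP x y : P x -> E x y -> ~ live lab x y.
  by case/decideP=> _ _ nex Exy lxy; case: nex; exists y.
exists (graph (attach_lab lab (P := P) l) (attach_edge E (P := P))), inl.
split; last exact: attach_embedding.
apply: based_amalgamation_base (@graph_is_graph _ _ _) _ _.
  exact: attach_Kage.
move=> [x|x] i /= root_x ui; last by rewrite npairE in root_x.
have [nx|nnx] := decideP (needs x).
  have Px : P x by apply/decideP.
  by exists (inr (exist _ x Px)); rewrite /live /= ?npairE; last apply: wP.
have [[y Exy lxy]|nex] := classic (exists2 y, E x y & live lab x y).
  by exists (inl y).
by case: nnx; split=> //; exists i.
Qed.

Lemma embedding_id L (A : structure L) : embedding (id : A -> A).
Proof.
have map_id_tuple n (xs : n.-tuple A) : map_tuple id xs = xs.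
  by apply: val_inj; apply: map_id.
by split=> // r xs; rewrite map_id_tuple.
Qed.

(** Otherwise a leaf for [i] could be hung below [x] in two extensions with different labels; in an
    amalgam both leaves would be live children of the image of [x]. *)
Lemma amalgamation_base_based A lab E :
  is_graph A lab E -> amalgamation_base Kage A -> based lab E.
Proof.
move=> gA [KA amalg] x i root_x ui; apply: NNPP => nex.
have [lab' [E' [gA' goodA' finA]]] := Kage_graph KA.
(* The identity embedding shows that the structure determines its labels and edges. *)
have [lab_eq E_eq] :
    (forall y, lab' y = lab y) /\ (forall y z, E' y z <-> E y z).
  by have /(graph_embedding _ gA gA')[] := embedding_id A.
(* The tag [k.+1] is nonzero, as for any leaf, and [k = 0, 1] give two labels for the same
   candidate. *)
pose P y := decide (y = x); pose w k (_ : A) := npair k.+1 i.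
have leafP k y : P y -> nfst (lab' y) = 0 /\ nfst (w k y) <> 0.
  by move/decideP->; rewrite lab_eq npairE.
have noP y z : P y -> E' y z -> ~ live lab' y z.
  move/decideP-> => /E_eq Exz lxz; case: nex; exists z => //.
  by move: lxz; rewrite /live !lab_eq.
have KB k : Kage (graph (attach_lab lab' (P := P) (w k)) (attach_edge E' (P := P))).
  exact: attach_Kage goodA' finA (leafP k) noP.
have [D [f [g [KD emb_f emb_g fg]]]] := amalg _ _ _ _ (KB 0) (KB 1)
  (attach_embedding _ _ gA') (attach_embedding _ _ gA').
have [labD [ED [gD [_ cohD] _]]] := Kage_graph KD.
case/(graph_embedding _ (@graph_is_graph _ _ _) gD): emb_f => f_inj f_lab f_edge.
case/(graph_embedding _ (@graph_is_graph _ _ _) gD): emb_g => g_inj g_lab g_edge.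
have Px : P x by apply/decideP.
pose b : attach P := inr (exist _ x Px).
have := cohD (f (inl x)) (f b) (g b).
rewrite f_edge fg g_edge /live f_lab !g_lab /=.
by rewrite /w !npairE lab_eq => /(_ erefl erefl ui ui)/npair_inj[].
Qed.

(** * The computable age *)

Lemma comp_eqb S (a : nat -> bool) b :
  computable_in S a -> computable_in S (fun n => a n == b).
Proof.
move=> ca; case: b; last by apply: comp_ext (comp_negb ca) => n; case: (a n).
by apply: comp_ext ca => n; case: (a n).
Qed.

Lemma computable_medge S x y : computable_in S x -> computable_in S y ->
  computable_in S (fun n => medge (x n) (y n)).
Proof.
move=> cx cy; rewrite /medge /mlab /mchildren /mmark /mstage; comp_tac.
by apply: computable_refuted; comp_tac.
Qed.

(** [b] selects between the relations and their complements. Arguments and labels are smaller than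
    the code [t], so the searches may stop there. *)
Definition msub_rel_dec (b : bool) (P : pred nat) t :=
  has (fun x => has (fun y =>
    [&& P x, P y, medge x y == b & t == scode [:: 0; scode [:: x; y]]])
    (iota 0 t)) (iota 0 t) ||
  has (fun x => has (fun l =>
    [&& P x, (mlab x == l) == b & t == scode [:: l.+1; scode [:: x]]])
    (iota 0 t)) (iota 0 t).

Lemma msub_rel_decP (b : bool) P t :
  (exists (r : rel_sym graph_lang) (xs : (rar r).-tuple (msub P)),
     (Defs.rel (msub P) r xs <-> b) /\ t = scode [:: val r; tcode xs]) <->
  msub_rel_dec b P t.
Proof.
have bound r s n : n \in s -> n \in iota 0 (scode [:: r; scode s]).
  move=> ns; rewrite mem_iota; apply: ltn_trans (mem_lt_scode ns) _.
  by apply: mem_lt_scode; rewrite !inE eqxx orbT.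
have eqb_iff (c : bool) : (c <-> b) -> c == b.
  by case=> cb bc; apply/eqP; apply/idP/idP.
split.
  case=> -[[|l] r] [[s size_s]]; case: s size_s => [|x [|y []]] //= size_s [rb ->].
    apply/orP; left; apply/hasP; exists (sval x).
      by apply: bound; rewrite mem_head.
    apply/hasP; exists (sval y); first by apply: bound; rewrite !inE eqxx orbT.
    by apply/and4P; split; [exact: svalP x | exact: svalP y | exact: eqb_iff |].
  apply/orP; right; apply/hasP; exists (sval x).
    by apply: bound; rewrite mem_head.
  apply/hasP; exists l; last first.
    apply/and3P; split; [exact: svalP x | | by []].
    by apply: eqb_iff; rewrite -rb; split=> /eqP.
  rewrite mem_iota; apply: ltn_trans (ltnSn l) _.
  by apply: (@mem_lt_scode _ [:: l.+1; scode [:: sval x]]); rewrite mem_head.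
case/orP=> /hasP[x _ /hasP[y _]].
  case/and4P=> Px Py /eqP eb /eqP->.
  exists (symb 0), [tuple exist _ x Px; exist _ y Py]; split=> //.
  by rewrite -eb.
case/and3P=> Px /eqP eb /eqP->.
exists (symb y.+1), [tuple exist _ x Px]; split=> //.
by rewrite -eb /=; split=> /eqP.
Qed.

(** * Programs with stored parameters and indices of structures *)

(** The parameter [k] is stored in the program as a constant. The search in [prog_halt] runs over a
    variable that the test ignores, so with a total test it ends at once or never. *)
Definition prog_at p k := PComp p (PPair (prog_const k) prog_id).
Definition prog_halt p k := PMu (PComp p (PPair (prog_const k) PFst)).

Lemma eval_prog_at S p k n y : eval S p (npair k n) y -> eval S (prog_at p k) n y.
Proof.
by apply: EComp; apply: EPair (eval_prog_const _ _ _) (eval_prog_id _ _).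
Qed.

Lemma prog_haltP S p k n (b : bool) : eval S p (npair k n) (~~ b) ->
  b <-> exists y, eval S (prog_halt p k) n y.
Proof.
move=> ev.
have evm m : eval S (PComp p (PPair (prog_const k) PFst)) (npair n m) (~~ b).
  apply: EComp ev; have := EFst S (npair n m); rewrite npairE.
  exact: EPair (eval_prog_const _ _ _).
split=> [bT | [y /eval_PMu_inv[_ ev0]]]; last first.
  by have := eval_functional (evm y) ev0; case: (b).
exists 0; apply: (EMu (r := fun=> 0)) => //.
by have := evm 0; rewrite bT.
Qed.

Lemma comp_gn_const S k :
  computable_in S k -> computable_in S (fun n => gn (prog_const (k n))).
Proof.
apply: (comp_comp (f := fun k => gn (prog_const k))).
pose F x := npair 6 (npair (gn PSucc) x).
apply: comp_ext (comp_iter (F := fun _ => F) (g := fun=> gn PZero) (b := id) _ _ _).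
- by elim=> //= n ->.
- by rewrite /F; comp_tac.
- exact: comp_const.
- exact: comp_id.
Qed.

Lemma decidable_ce S (A : nat -> Prop) (b : nat -> bool) :
  (forall n, A n <-> b n) -> computable_in S b -> ce S A.
Proof.
move=> Ab cb; have [p pb] : computable_in S (fun m => ~~ b (nsnd m)).
  by apply: (comp_comp (f := fun n => ~~ b n)); [apply: comp_negb | comp_tac].
exists (prog_halt p 0) => n; rewrite Ab; apply: prog_haltP.
by have := pb (npair 0 n); rewrite npairE.
Qed.

(** One program serves the whole family; [i] enters as a stored constant, whose Goedel number is
    computable from [i]. *)
Lemma msub_index (P : nat -> pred nat) :
  computable_in no_oracle (fun m => P (nfst m) (nsnd m)) ->
  exists2 idx, computable_in no_oracle idx &
    forall i, is_index (idx i) (msub (P i)).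
Proof.
move=> cP; have [pd pdP] := cP.
have cR b : computable_in no_oracle
    (fun m => ~~ msub_rel_dec b (P (nfst m)) (nsnd m)).
  rewrite /msub_rel_dec /mlab /=; comp_tac;
    do ?[by apply: (comp_comp2 (F := P)); comp_tac
        |by apply: comp_eqb; apply: computable_medge; comp_tac
        |by apply: comp_eqb; comp_tac].
have [pr prP] := cR true; have [pn pnP] := cR false.
(* [PMu PSucc] never halts: it semidecides the empty set of function values. *)
exists (fun i => scode [:: gn (prog_at pd i); gn (prog_halt pr i);
                           gn (prog_halt pn i); gn (PMu PSucc)]).
  by rewrite /=; comp_tac; apply: comp_gn_const; comp_tac.
move=> i; exists (prog_at pd i), (prog_halt pr i), (prog_halt pn i), (PMu PSucc).
split=> //; split.
- by move=> n; apply: eval_prog_at; have := pdP (npair i n); rewrite !npairE.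
- move=> t; have := prP (npair i t); rewrite !npairE => /prog_haltP <-.
  rewrite -msub_rel_decP; split=> -[r [xs [rxs ->]]]; exists r, xs; split=> //.
  exact/rxs.
- move=> t; have := pnP (npair i t); rewrite !npairE => /prog_haltP <-.
  rewrite -msub_rel_decP; split=> -[r [xs [rxs ->]]]; exists r, xs; split=> //.
  by move/rxs.
- move=> t; split=> [[g] | [y /eval_PMu_inv[_ ev0]]]; first by case: (notF (valP g)).
  by inversion ev0.
Qed.

Lemma map_val_pmap (P : pred nat) s : all P s ->
  map (fun x : {n | P n} => sval x) (pmap insub s) = s.
Proof. by elim: s => //= x s IH /andP[Px /IH eq_s]; rewrite insubT /= eq_s. Qed.

Lemma in_sval (P : pred nat) (x : {n | P n}) s :
  List.In x s <-> sval x \in map sval s.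
Proof.
elim: s => //= y s IH; rewrite inE; split.
  by case=> [->|/IH xs]; apply/orP; [left | right].
by case/predU1P=> [/val_inj->|/IH]; [left | right].
Qed.

Lemma in_cl_graph (A : structure graph_lang) (a : seq A) x :
  in_cl a x <-> List.In x a.
Proof. by split=> [[]// g | /in_cl_gen//]; case: (notF (valP g)). Qed.

(** * The canonical age and the bound computed from a witness *)

Definition tuple_gen i : seq (tuple_str i) := pmap insub (decode (nfst i)).

Lemma map_tuple_gen i : map sval (tuple_gen i) = decode (nfst i).
Proof. by apply: map_val_pmap; apply/allP. Qed.

Lemma tuple_gen_generates i : generates (tuple_gen i).
Proof.
move=> x; apply/in_cl_gen/in_sval; rewrite map_tuple_gen; exact: svalP x.
Qed.

Lemma tcode_tuple_gen i : tcode (tuple_gen i) = nfst i.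
Proof. by rewrite /tcode map_tuple_gen decodeK. Qed.

Lemma mem_str_lt i (x : tuple_str i) : sval x < i.
Proof.
apply: leq_trans (mem_lt_scode (svalP x)) _.
by rewrite decodeK nfst_le.
Qed.

Lemma tval_mktuple1 T (x : T) : tval [tuple x | _ < 1] = [:: x].
Proof.
have := tnth_mktuple (fun _ : 'I_1 => x) ord0.
by case/tupleP: [tuple x | _ < 1] => y t; rewrite (tuple0 t) tnth0 /= => ->.
Qed.

Section Age.

Variable idx : nat -> nat.
Hypothesis idxP : forall i, is_index (idx i) (tuple_str i).
Hypothesis idx_computable : computable_in no_oracle idx.

Lemma tuple_triples_ce : ce no_oracle
  (fun t => exists i, t = scode [:: tcode (tuple_gen i); idx i; i]).
Proof.
apply: (decidable_ce
  (b := fun t => has (fun i => t == scode [:: nfst i; idx i; i]) (iota 0 t))).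
  move=> t; split=> [[i ->] | /hasP[i _ /eqP->]]; last first.
    by exists i; rewrite tcode_tuple_gen.
  rewrite tcode_tuple_gen; apply/hasP; exists i => //.
  by rewrite mem_iota; apply: mem_lt_scode; rewrite !inE eqxx !orbT.
by rewrite /=; comp_tac; apply: (comp_comp (f := idx)); comp_tac.
Qed.

Definition tuple_age : computable_age graph_lang :=
  ComputableAge idxP tuple_gen_generates tuple_triples_ce.

Lemma canonical_tuple_age : canonical_age (msub xpredT) tuple_age.
Proof.
pose a i : seq (msub xpredT) := pmap insub (decode (nfst i)).
have aE i : map sval (a i) = decode (nfst i) by apply: map_val_pmap; apply/allP.
pose incl i (x : tuple_str i) : msub xpredT := exist _ (sval x) isT.
exists a, incl; split.
- have [p pP] := comp_nfst (comp_id no_oracle); exists p => i.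
  by rewrite /tcode aE decodeK.
(* The counter [n] makes the index at least [n]. *)
- move=> s n; exists (npair (tcode s) n); split; first exact: npair_ler.
  by apply: (inj_map val_inj); rewrite /= aE npairE scodeK.
- move=> i; split=> //.
  + apply/(graph_embedding _ (@is_graph_msub _) (@is_graph_msub _)).
    by split=> // x y [/val_inj].
  + move=> y; rewrite in_cl_graph in_sval aE; split=> [yi | [x <-]].
      by exists (exist _ (sval y) yi); apply: val_inj.
    exact: svalP x.
  + apply: (inj_map val_inj); rewrite /= aE -map_comp.
    exact: map_tuple_gen.
Qed.

(** For each [z] the oracle finds a distinguished extension of the structure whose only point is a
    root for [z]. The codomain is an amalgamation base, hence based, so the image of the root has a
    live child if [z] has an unrefuted candidate. The number of the codomain bounds its elements and
    so the candidate of that child. *)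
Lemma cCAP_bound S : cCAP S Kage tuple_age ->
  exists2 h, computable_in S h & forall z,
    (exists i, unrefuted z i) -> exists2 i, i <= h z & unrefuted z i.
Proof.
case=> AB [f [[[AB_emb _ _ AB_total] AB_base _] [[p pP] _]]].
pose root z := npair (npair 0 z) 0.
pose single z := npair (scode [:: root z]) 0.
(* [m] codes a certificate, the codomain, the code of the tuple, and the output of the semidecision
   procedure. *)
pose query z m := scode [:: single z; nfst (nsnd m); nfst (nsnd (nsnd m))].
pose found z m := valid (fun n => decide (S n)) (decode (nfst m)) &&
  (evj (gn p) (query z m) (nsnd (nsnd (nsnd m))) \in decode (nfst m)).
have SP n : reflect (S n) (decide (S n)) by exact: decideP.
have [|z|m cm mP] := @comp_search S found.
- rewrite /found /query /single /root /evj /=; comp_tac.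
  by apply: (computable_valid (O := fun _ n => decide (S n))); comp_tac.
- have [j [F ABF]] := AB_total (single z).
  have [|y /(eval_valid _ _ _ SP)[s vs ys]] := (pP (ecode F)).1.
    by exists (single z), j, F.
  exists (npair (scode s) (npair j (npair (tcode (tup F)) y))).
  by rewrite /found /query !npairE scodeK vs.
exists (fun z => nfst (nsnd (m z))); first by comp_tac.
move=> z [i ui]; have /andP[vs ys] := mP z.
have : exists y, eval S p (query z (m z)) y.
  exists (nsnd (nsnd (nsnd (m z)))); apply/(eval_valid _ _ _ SP).
  by exists (decode (nfst (m z))).
case/pP=> i' [j [F [ABF /(can_inj scodeK)[ei ej _]]]]; rewrite ej; subst i'.
have [n [u [v [eu ev uv]]]] := AB_emb _ _ _ ABF.
have {}eu : tuple_gen (single z) = u by [].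
(* The empty tuple is excluded, as the generating tuple of [single z] has one entry. *)
case: n u v eu ev uv => [|n] u v eu ev uv.
  have := congr1 size (map_tuple_gen (single z)).
  by rewrite npairE scodeK size_map eu size_tuple.
have lab_u : mlab (sval (tnth u ord0)) = npair 0 z.
  have : sval (tnth u ord0) \in map sval (tuple_gen (single z)).
    by rewrite eu; apply/map_f/mem_tnth.
  by rewrite map_tuple_gen npairE scodeK inE => /eqP->; rewrite /mlab npairE.
have lab_v : mlab (sval (tnth v ord0)) = npair 0 z.
  (* The atomic formula that states the label of the root passes to its image. *)
  have := uv (@ARel graph_lang n.+1 (symb (npair 0 z).+1) (fun=> @Var _ _ ord0)).
  by rewrite /holds /= /Defs.rel /= !tval_mktuple1; case=> /(_ lab_u).
have := amalgamation_base_based (@is_graph_msub _) (AB_base _ _ _ ABF).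
case/(_ (tnth v ord0) i); rewrite ?lab_v ?npairE // => y _.
rewrite /live lab_v npairE => uy; exists (nsnd (mlab (sval y))) => //.
(* The candidate is at most the label, which is at most the element, which is below the number of
   its structure. *)
apply: leq_trans (nsnd_le _) _; apply: leq_trans (nfst_le _) _.
exact/ltnW/mem_str_lt.
Qed.

End Age.

(** * Isomorphism of structures and the conclusion *)

Lemma map_tuple_K (T U : Type) (f : T -> U) g n (xs : n.-tuple U) :
  cancel g f -> map_tuple f (map_tuple g xs) = xs.
Proof. by move=> gK; apply: val_inj; apply: mapK. Qed.

Lemma isomorphic_refl L (A : structure L) : isomorphic A A.
Proof. by exists id; split; [apply: embedding_id | move=> y; exists y]. Qed.

Lemma isomorphic_sym L (A B : structure L) : isomorphic A B -> isomorphic B A.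
Proof.
case=> f [[f_inj f_rel f_fn] /choice[g gK]]; exists g; split.
  split; first exact: can_inj gK.
    by move=> r xs; rewrite f_rel map_tuple_K.
  by move=> h xs; apply: f_inj; rewrite gK f_fn map_tuple_K.
by move=> x; exists (f x); apply: f_inj; rewrite gK.
Qed.

Lemma isomorphic_trans L (A B C : structure L) :
  isomorphic A B -> isomorphic B C -> isomorphic A C.
Proof.
case=> f [[f_inj f_rel f_fn] f_onto] [g [[g_inj g_rel g_fn] g_onto]].
have map_gf n (xs : n.-tuple A) :
    map_tuple (g \o f) xs = map_tuple g (map_tuple f xs).
  by apply: val_inj; apply: map_comp.
exists (g \o f); split.
  split; first exact: inj_comp.
    by move=> r xs; rewrite map_gf -g_rel.
  by move=> h xs; rewrite map_gf /= f_fn g_fn.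
by move=> z; have [y <-] := g_onto z; have [x <-] := f_onto y; exists x.
Qed.

Lemma Kage_is_age : is_age Kage.
Proof.
split=> [A /Kage_graph[_ [_ [_ _ [s sA]]]] | A B [i isoA] isoAB].
  by exists s => x; apply: in_cl_gen.
by exists i; apply: isomorphic_trans (isomorphic_sym isoAB) isoA.
Qed.

Theorem theorem7p5 :
  exists (L : language) (K : structure L -> Prop) (KK : computable_age L)
         (M : nstructure L),
    [/\ is_age K, represents KK K, computable_structure M,
        canonical_age M KK & CAP K] /\
    forall S : nat -> Prop,
      cCAP S K KK -> turing_le (jump (jump no_oracle)) S.
Proof.
have [|idx idx_computable idxP] := @msub_index (fun i n => n \in decode (nfst i)).
  by comp_tac.
have [|idxM _ idxMP] := @msub_index (fun=> xpredT); first exact: comp_const.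
exists graph_lang, Kage, (tuple_age idxP idx_computable), (msub xpredT); split.
  split.
  - exact: Kage_is_age.
  - by split=> // i; exists i; apply: isomorphic_refl.
  - by exists (idxM 0).
  - exact: canonical_tuple_age.
  - exact: Kage_CAP.
move=> S /cCAP_bound[h ch hP]; exact: bound_decides_jump2 ch hP.
Qed.
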